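(* Let $\Gamma=(X,R)$ be a bipartite distance-regular graph with diameter $D\ge4$ and valency $k\ge3$, and fix $x\in X$. For every $\eta\in\mathbb{R}$, the scalar $\mu_\eta$ equals the dimension of $E^*_2H_\eta$, and moreover $\mathrm{mult}_\eta\ge\mu_\eta$.
   Context: $\Gamma$ is a finite connected bipartite distance-regular graph with distance $\partial$, intersection numbers $b_i,c_i$, $k_2$ the number of vertices at distance $2$ from $x$. $A_i$ distance matrices, $A=A_1$; $V=\mathbb{C}^X$ with $\langle u,w\rangle=u^t\bar w$. $E^*_i$ diagonal with $(y,y)$-entry $1$ if $\partial(x,y)=i$, else $0$; $T=T(x)$ generated by $A,E^*_0,\dots,E^*_D$; $T$-modules, irreducibility, isomorphism as usual; thin: $\dim E^*_iW\le1$ for all $i$; endpoint $\min\{i:E^*_iW\ne0\}$; local eigenvalue of a thin irreducible $W$ with endpoint 2: eigenvalue of $E^*_2A_2E^*_2$ on $E^*_2W$. $V$ is an orthogonal direct sum of irreducible $T$-modules; the multiplicity with which an irreducible $W$ appears in $V$ is the number of summands isomorphic to $W$ in such a decomposition. $\mu_\eta$ is the multiplicity with which $W$ appears in $V$, where $W$ is any thin irreducible $T$-module with endpoint $2$ and local eigenvalue $\eta$ (all such are isomorphic); $\mu_\eta=0$ if no such $W$ exists. $H_\eta$ is the subspace of $V$ spanned by all thin irreducible $T$-modules with endpoint 2 and local eigenvalue $\eta$. Let $\Gamma^2_2$ be the graph on the vertices at distance $2$ from $x$, two being adjacent when at distance $2$ in $\Gamma$; its adjacency eigenvalues (local eigenvalues)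 $\eta_1,\dots,\eta_{k_2}$ are ordered so that $\eta_1=p^2_{22}$ and $\eta_i=b_3-1$ for $2\le i\le k$. $\mathrm{mult}_\eta$ is the number of times $\eta$ appears among $\eta_{k+1},\dots,\eta_{k_2}$; equivalently $\mathrm{mult}_\eta=\dim U_\eta$, where $U$ is the orthogonal complement in $E^*_2V$ of $E^*_2V_0+E^*_2Y$ ($V_0$ the unique irreducible $T$-module with endpoint $0$, $Y$ the span of all irreducible $T$-modules with endpoint $1$) and $U_\eta=\{u\in U: E^*_2A_2E^*_2u=\eta u\}$. *)

(* Defs.v *)
From mathcomp Require Import all_boot all_order all_algebra.
From mathcomp Require Import complex.
From mathcomp Require Import boolp classical_sets reals.

Set Implicit Arguments.
Unset Strict Implicit.
Unset Printing Implicit Defensive.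

Import Order.TTheory GRing.Theory Num.Theory.
Local Open Scope ring_scope.

Section Graph.
Variables (X : finType) (e : rel X).

Definition walk (n : nat) (y z : X) : bool :=
  [exists p : n.-tuple X, path e y p && (last y p == z)].

(* Two vertices in the same connected component are joined by a walk with
   fewer than #|X| edges; the value is #|X| if there is no walk at all. *)
Definition gdist (y z : X) : nat := find (fun n => walk n y z) (iota 0 #|X|).

Definition diameter : nat := (\max_(y : X) \max_(z : X) gdist y z)%N.

Definition bipartite : Prop :=
  exists f : X -> bool, forall y z, e y z -> f y != f z.

Definition sphere (i : nat) (y : X) : {set X} := [set z | gdist y z == i].

Definition distance_regular : Prop :=
  forall (i j : nat) (y z y' z' : X), gdist y z = gdist y' z' ->
    #|sphere i y :&: sphere j z| = #|sphere i y' :&: sphere j z'|.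

(* p^h_{ij}, read off from some pair of vertices at distance h. *)
Definition inter_num (h i j : nat) : nat :=
  if [pick yz : X * X | gdist yz.1 yz.2 == h] is Some yz
  then #|sphere i yz.1 :&: sphere j yz.2| else 0%N.

Definition inter_b (i : nat) : nat := inter_num i 1 i.+1.

Definition valency : nat := inter_b 0.

End Graph.

Section Terwilliger.
Variables (R : realType) (X : finType) (e : rel X) (x : X).

Local Notation C := R[i].
Local Notation V := 'cV[C]_#|X|.
Local Notation MatX := 'M[C]_#|X|.

Definition dist_mx (i : nat) : MatX :=
  \matrix_(a, b) (gdist e (enum_val a) (enum_val b) == i)%:R.

Definition dual_idem (i : nat) : MatX :=
  \matrix_(a, b) ((a == b) && (gdist e x (enum_val a) == i))%:R.

Inductive inT : MatX -> Prop :=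
| inT_adj : inT (dist_mx 1)
| inT_dual i : (i <= diameter e)%N -> inT (dual_idem i)
| inT_one : inT 1%:M
| inT_add B B' : inT B -> inT B' -> inT (B + B')
| inT_scale a B : inT B -> inT (a *: B)
| inT_mul B B' : inT B -> inT B' -> inT (B *m B').

Definition mximg (B : MatX) (W : {vspace V}) : {vspace V} :=
  (linfun (mulmx B : V -> V) @: W)%VS.

Local Notation "i .-sub W" := (mximg (dual_idem i) W)
  (at level 2, format "i .-sub  W").

Definition herm (u w : V) : C := \sum_a u a 0 * (w a 0)^*.

Definition orthogonal_sub (U W : {vspace V}) : Prop :=
  forall u w, u \in U -> w \in W -> herm u w = 0.

Definition Tmodule (W : {vspace V}) : Prop :=
  forall B w, inT B -> w \in W -> B *m w \in W.

Definition Tirreducible (W : {vspace V}) : Prop :=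
  [/\ Tmodule W, W != 0%VS &
      forall U : {vspace V}, Tmodule U -> (U <= W)%VS -> U = 0%VS \/ U = W].

(* Every linear map W -> W' is the restriction of an endomorphism f of V. *)
Definition Tisomorphic (W W' : {vspace V}) : Prop :=
  exists f : 'End(V),
    [/\ (f @: W)%VS = W', (W :&: lker f)%VS = 0%VS &
        forall B w, inT B -> w \in W -> f (B *m w) = B *m f w].

Definition thin (W : {vspace V}) : Prop :=
  forall i, (i <= diameter e)%N -> (\dim (i.-sub W) <= 1)%N.

Definition endpoint (W : {vspace V}) : nat :=
  find (fun i => i.-sub W != 0%VS) (iota 0 (diameter e).+1).

Definition local_eigenvalue (W : {vspace V}) (eta : R) : Prop :=
  exists w : V, [/\ w \in 2.-sub W, w != 0 &
    dual_idem 2 *m dist_mx 2 *m dual_idem 2 *m w = (eta%:C)%C *: w].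

Definition thin_endpoint2 (eta : R) (W : {vspace V}) : Prop :=
  [/\ Tirreducible W, thin W, endpoint W = 2%N & local_eigenvalue W eta].

(* Irreducible modules are nonzero, so orthogonality makes the sum direct. *)
Definition orthogonal_decomposition (s : seq {vspace V}) : Prop :=
  [/\ forall W, W \in s -> Tirreducible W,
      forall i j, (i < j < size s)%N ->
        orthogonal_sub (nth 0%VS s i) (nth 0%VS s j) &
      (\sum_(W <- s) W)%VS = fullv].

(* The count does not depend on the decomposition selected by xget, nor does
   mu depend on the selected module: all modules in thin_endpoint2 eta are
   isomorphic. *)
Definition multiplicity (W : {vspace V}) : nat :=
  count (fun U => `[< Tisomorphic U W >])
        (xget [::] [set s | orthogonal_decomposition s]%classic).

Definition mu (eta : R) : nat :=
  if `[< exists W, thin_endpoint2 eta W >]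
  then multiplicity (xget 0%VS [set W | thin_endpoint2 eta W]%classic)
  else 0%N.

Definition is_span (P : {vspace V} -> Prop) (U : {vspace V}) : Prop :=
  forall v, v \in U <->
    exists s : seq {vspace V},
      (forall W, W \in s -> P W) /\ v \in (\sum_(W <- s) W)%VS.

Definition span_of (P : {vspace V} -> Prop) : {vspace V} :=
  xget 0%VS [set U | is_span P U]%classic.

Lemma span_ofP (P : {vspace V} -> Prop) : is_span P (span_of P).
Proof.
suff [U HU] : exists U, is_span P U by apply: (xgetI 0%VS HU).
pose Q m := `[< exists s : seq {vspace V},
  (forall W, W \in s -> P W) /\ \dim (\sum_(W <- s) W)%VS = m >].
have Q0 : exists m, Q m.
  by exists (\dim (\sum_(W <- [::] : seq {vspace V}) W)%VS); apply/asboolP; exists [::].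
have Qb m : Q m -> (m <= \dim {:V})%N.
  by case/asboolP => s [_ <-]; apply/dimvS/subvf.
case: (ex_maxnP Q0 Qb) => m /asboolP[s [sP sm]] maxm.
exists (\sum_(W <- s) W)%VS => v; split=> [vs|[t [tP vt]]]; first by exists s.
have sub : (\sum_(W <- s) W <= \sum_(W <- s ++ t) W)%VS.
  by rewrite big_cat addvSl.
have : (\sum_(W <- s) W)%VS == (\sum_(W <- s ++ t) W)%VS.
  rewrite eqEdim sub sm; apply: maxm; apply/asboolP; exists (s ++ t).
  by split=> // W; rewrite mem_cat => /orP[/sP|/tP].
move/eqP->; rewrite big_cat /=; exact: (subvP (addvSr _ _)) vt.
Qed.

Definition Hsub (eta : R) : {vspace V} := span_of (thin_endpoint2 eta).

Local Notation X2 := (sphere e 2 x).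

Definition adj22 : 'M[R]_#|X2| :=
  \matrix_(a, b) (gdist e (enum_val a) (enum_val b) == 2)%:R.

(* s lists eta_1, ..., eta_{k_2} (starting at index 0), with multiplicity. *)
Definition local_spectrum (s : seq R) : Prop :=
  char_poly adj22 = \prod_(a <- s) ('X - a%:P) /\
  take (valency e) s =
    (inter_num e 2 2 2)%:R :: nseq (valency e).-1 ((inter_b e 3)%:R - 1).

(* All such s are permutations of each other with the same first k entries, so
   the count does not depend on the choice. *)
Definition mult (eta : R) : nat :=
  count_mem eta (drop (valency e) (xget [::] [set s | local_spectrum s]%classic)).

End Terwilliger.

(* Main.v *)
(* A thin irreducible module W with endpoint 2 is spanned by the vectors
   r_n = E*_{n+2} A ... E*_3 A v with v in E*_2 W, on which A is tridiagonal; its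
   entries are ratios of the norms |r_n|^2. Inductively r_n = B v for some B in
   the Bose-Mesner algebra, and E*_2 B v is a multiple of v depending only on B
   and the local eigenvalue, so all these norms, hence W up to isomorphism, are
   determined by the local eigenvalue. By Schur's lemma H_eta is then the sum of
   the summands isomorphic to W in any orthogonal decomposition, and each
   contributes one dimension to E*_2 H_eta.

   For the inequality let N be the incidence matrix between the spheres of radius
   2 and 1 around x. Its column space E*_2 V_0 + E*_2 Y carries the eigenvalues
   p^2_22 (once) and b_3 - 1 (k - 1 times) of the local graph. Since E*_1 H_eta
   vanishes, E*_2 H_eta is orthogonal to this column space, so inside the
   eta-eigenspace its dimension adds to the multiplicity of eta there. *)
Require Import Defs.
From mathcomp Require Import all_boot all_order all_algebra.
From mathcomp Require Import complex.
From mathcomp Require Import reals.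
From mathcomp Require Import boolp zify.

Set Implicit Arguments.
Unset Strict Implicit.
Unset Printing Implicit Defensive.

Import Order.TTheory GRing.Theory Num.Theory.
Local Open Scope ring_scope.

(** * Distance in a connected graph *)

Section Distance.
Variables (X : finType) (e : rel X).
Hypothesis e_sym : symmetric e.
Hypothesis e_irr : irreflexive e.
Hypothesis e_conn : forall y z : X, connect e y z.

Local Notation dd := (gdist e).
Local Notation D := (diameter e).

Lemma walk0 y z : walk e 0 y z = (y == z).
Proof.
apply/existsP/eqP => [[p]|->]; last by exists [tuple]; rewrite /= eqxx.
by rewrite tuple0 /= => /eqP.
Qed.

Lemma walkS n y z : walk e n.+1 y z <-> exists2 w, e y w & walk e n w z.
Proof.
split.
  case/existsP => p; case/tupleP: p => w p /= /andP[/andP[yw wp] l].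
  by exists w => //; apply/existsP; exists p; rewrite wp.
case=> w yw /existsP[p /andP[wp l]].
by apply/existsP; exists [tuple of w :: p]; rewrite /= yw wp.
Qed.

Lemma walkD m n y w z : walk e m y w -> walk e n w z -> walk e (m + n) y z.
Proof.
elim: m y => [|m IH] y; first by rewrite walk0 => /eqP->.
by move=> /walkS[u yu uw] wz; rewrite addSn; apply/walkS; exists u => //; apply: IH.
Qed.

Lemma walk1 y z : walk e 1 y z = e y z.
Proof.
apply/idP/idP => [/walkS[w yw]|yz]; first by rewrite walk0 => /eqP <-.
by apply/walkS; exists z => //; rewrite walk0.
Qed.

Lemma walk_sym n y z : walk e n y z -> walk e n z y.
Proof.
elim: n y z => [|n IH] y z; first by rewrite !walk0 eq_sym.
move=> /walkS[w yw /IH wz]; rewrite -addn1; apply: walkD wz _.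
by rewrite walk1 e_sym.
Qed.

Lemma gdist_le n y z : walk e n y z -> (dd y z <= n)%N.
Proof.
move=> yz; rewrite leqNgt; apply/negP => lt.
have nX : (n < #|X|)%N.
  by apply: leq_trans lt _; rewrite -[leqRHS](size_iota 0); apply: find_size.
by move: (before_find 0%N lt); rewrite nth_iota // add0n yz.
Qed.

Lemma gdist_walk y z : walk e (dd y z) y z.
Proof.
have has_walk : has (fun n => walk e n y z) (iota 0 #|X|).
  have /connectP[p yp ->] := e_conn y z.
  case/shortenP: yp => p' yp' up' _; apply/hasP; exists (size p').
    rewrite mem_iota /= add0n; apply: leq_trans (max_card (mem (y :: p'))).
    by rewrite (card_uniqP up').
  by apply/existsP; exists (in_tuple p'); rewrite /= yp' eqxx.
have := nth_find 0%N has_walk; rewrite nth_iota ?add0n //.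
by rewrite -[ltnRHS](size_iota 0) -has_find.
Qed.

Lemma gdist_sym y z : dd y z = dd z y.
Proof. by apply/eqP; rewrite eqn_leq !gdist_le // walk_sym // gdist_walk. Qed.

Lemma gdist_triangle w y z : (dd y z <= dd y w + dd w z)%N.
Proof. by apply: gdist_le; apply: walkD (gdist_walk _ _) (gdist_walk _ _). Qed.

Lemma gdist_eq0 y z : (dd y z == 0%N) = (y == z).
Proof.
apply/eqP/eqP => [yz|->]; first by move: (gdist_walk y z); rewrite yz walk0 => /eqP.
by apply/eqP; rewrite -leqn0 gdist_le // walk0.
Qed.

Lemma gdistxx y : dd y y = 0%N.
Proof. by apply/eqP; rewrite gdist_eq0. Qed.

Lemma gdist_eq1 y z : (dd y z == 1%N) = e y z.
Proof.
apply/eqP/idP => [yz|yz]; first by move: (gdist_walk y z); rewrite yz walk1.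
apply/eqP; rewrite eqn_leq gdist_le ?walk1 //= lt0n gdist_eq0.
by apply: contraTneq yz => ->; rewrite e_irr.
Qed.

Lemma gdist_step n y z : dd y z = n.+1 -> exists2 w, e y w & dd w z = n.
Proof.
move=> yz; move: (gdist_walk y z); rewrite yz => /walkS[w yw wz].
exists w => //; apply/eqP; rewrite eqn_leq gdist_le //.
move: yw; rewrite -gdist_eq1 => /eqP yw.
by have := gdist_triangle w y z; rewrite yz yw.
Qed.

Lemma gdist_diameter y z : (dd y z <= D)%N.
Proof.
apply: leq_trans (leq_bigmax y); exact: (leq_bigmax z).
Qed.

(** Some pair has distance at least n, since otherwise the diameter would be at most n - 1. Moving
    along a geodesic towards z lowers the distance by one at a time until it is n. *)
Lemma gdist_attained n : (0 < n <= D)%N -> exists y z, dd y z = n.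
Proof.
move=> /andP[n0 nD].
have [y /existsP[z nz]] : exists y, [exists z, n <= dd y z]%N.
  apply/existsP; apply: contraLR nD => /existsPn far.
  have far' y z : (dd y z <= n.-1)%N.
    by move/existsPn/(_ z): (far y); lia.
  have : (D <= n.-1)%N by do 2![apply/bigmax_leqP => ? _].
  by lia.
have [m] : exists m, dd y z = (n + m)%N by exists (dd y z - n)%N; lia.
elim: m y {nz} => [|m IH] y; first by rewrite addn0; exists y, z.
by rewrite addnS => /gdist_step[w _]; apply: IH.
Qed.

Section Bipartite.
Hypothesis e_bip : bipartite e.

(** The 2-colouring decides the parity of every walk: its length is odd exactly when its ends have
    different colours. *)
Lemma gdist_parity y z w : odd (dd y w) = odd (dd y z) (+) odd (dd z w).
Proof.
have [f fe] := e_bip.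
have wf n u v : walk e n u v -> odd n = (f u != f v).
  elim: n u => [|n IH] u; first by rewrite walk0 => /eqP->; rewrite eqxx.
  move=> /walkS[u' uu' /IH /= ->].
  by have := fe _ _ uu'; case: (f u); case: (f u'); case: (f v).
rewrite (wf _ _ _ (gdist_walk y w)) (wf _ _ _ (gdist_walk y z)).
rewrite (wf _ _ _ (gdist_walk z w)).
by case: (f y); case: (f z); case: (f w).
Qed.

Lemma gdist_adj x y w : e y w -> dd x y = (dd x w).+1 \/ dd x w = (dd x y).+1.
Proof.
rewrite -gdist_eq1 => /eqP yw.
have := gdist_triangle w x y; have := gdist_triangle y x w.
have := gdist_parity x y w.
by rewrite (gdist_sym w y) yw addbT; move: (dd x y) (dd x w) => a b; lia.
Qed.

End Bipartite.

Section Regular.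
Hypothesis e_dreg : distance_regular e.

Lemma inter_numE h i j y z : dd y z = h ->
  inter_num e h i j = #|sphere e i y :&: sphere e j z|.
Proof.
move=> yz; rewrite /inter_num; case: pickP => [[y' z'] /= /eqP h'|/(_ (y, z))].
  by apply: e_dreg; rewrite h' yz.
by rewrite /= yz eqxx.
Qed.

Lemma inter_num_2_1_1_gt0 : (2 <= D)%N -> (0 < inter_num e 2 1 1)%N.
Proof.
move=> D2; have [y [z yz]] : exists y z, dd y z = 2%N by apply: gdist_attained.
rewrite (inter_numE _ _ yz); apply/card_gt0P.
have [w yw wz] := gdist_step yz.
by exists w; rewrite !inE (gdist_sym z w) wz eqxx andbT gdist_eq1.
Qed.

Lemma valencyE y : valency e = #|sphere e 1 y|.
Proof. by rewrite /valency /inter_b (inter_numE _ _ (gdistxx y)) setIid. Qed.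

End Regular.

End Distance.

(** * Hermitian form and level decomposition *)

Lemma vlineW (K : fieldType) (vT : vectType K) (W : {vspace vT}) (u v : vT) :
  (\dim W <= 1)%N -> u \in W -> v \in W -> u != 0 -> exists b, v = b *: u.
Proof.
move=> W1 uW vW u0; apply/vlineP.
suff <- : W = <[u]>%VS by [].
by apply/esym/eqP; rewrite eqEdim -memvE uW dim_vline u0.
Qed.

Section HermitianForm.
Variables (R : realType) (X : finType).
Local Notation V := 'cV[R[i]]_#|X|.
Implicit Types u v w : V.

Lemma hermDl u v w : herm (u + v) w = herm u w + herm v w.
Proof. by rewrite -big_split; apply: eq_bigr => a _; rewrite mxE mulrDl. Qed.

Lemma hermZl c u w : herm (c *: u) w = c * herm u w.
Proof. by rewrite mulr_sumr; apply: eq_bigr => a _; rewrite mxE mulrA. Qed.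

Lemma herm_conj u w : (herm w u)^* = herm u w.
Proof.
by rewrite /herm rmorph_sum; apply: eq_bigr => a _; rewrite rmorphM /= conjCK mulrC.
Qed.

Lemma hermZr c u w : herm u (c *: w) = c^* * herm u w.
Proof. by rewrite -herm_conj hermZl rmorphM /= herm_conj. Qed.

Lemma hermDr u v w : herm u (v + w) = herm u v + herm u w.
Proof. by rewrite -herm_conj hermDl rmorphD /= !herm_conj. Qed.

Lemma herm0l w : herm 0 w = 0.
Proof. by rewrite -(scale0r 0) hermZl mul0r. Qed.

Lemma herm_eq0 u : (herm u u == 0) = (u == 0).
Proof.
apply/idP/eqP => [|->]; last by rewrite herm0l.
rewrite psumr_eq0 => [/allP u0|a _]; last exact: mul_conjC_ge0.
apply/colP => a; rewrite mxE; apply/eqP; rewrite -mul_conjC_eq0.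
exact: u0 (mem_index_enum a).
Qed.

Lemma herm_sym0 u w : herm u w = 0 -> herm w u = 0.
Proof. by move=> uw; rewrite -herm_conj uw rmorph0. Qed.

Lemma herm_suml (I : Type) (r : seq I) (P : pred I) (F : I -> V) w :
  herm (\sum_(i <- r | P i) F i) w = \sum_(i <- r | P i) herm (F i) w.
Proof.
by elim/big_rec2: _ => [|i y1 y2 _ <-]; rewrite ?herm0l // hermDl.
Qed.

Lemma herm_adj (B : 'M[R[i]]_#|X|) u w :
  (forall a b, (B a b)^* = B b a) -> herm (B *m u) w = herm u (B *m w).
Proof.
move=> Bh; rewrite /herm.
under eq_bigr do rewrite mxE mulr_suml.
under [RHS]eq_bigr do rewrite mxE rmorph_sum mulr_sumr.
rewrite exchange_big; apply: eq_bigr => a _; apply: eq_bigr => b _.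
by rewrite rmorphM /= Bh mulrCA mulrA.
Qed.

(** Rank-one operators of this kind are the building blocks of [raise_map] and [gram_map]. *)
Lemma outer_mul u w r : u *m (map_mx Num.conj r)^T *m w = herm w r *: u.
Proof.
rewrite -mulmxA; suff -> : (map_mx Num.conj r)^T *m w = (herm w r)%:M.
  by rewrite mul_mx_scalar.
apply/matrixP => i j; rewrite !ord1 !mxE mulr1n; apply: eq_bigr => a _.
by rewrite !mxE mulrC.
Qed.

End HermitianForm.

(** * Levels around x and the Bose-Mesner algebra *)

Section Vectors.
Variables (R : realType) (X : finType) (e : rel X) (x : X).
Hypothesis e_sym : symmetric e.
Hypothesis e_irr : irreflexive e.
Hypothesis e_conn : forall y z : X, connect e y z.

Local Notation C := R[i].
Local Notation V := 'cV[C]_#|X|.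
Local Notation dd := (gdist e).
Local Notation D := (diameter e).
Local Notation Aj := (dist_mx R e 1).
Local Notation Ed i := (dual_idem R e x i).
Local Notation ev a := (enum_val a : X).
Local Notation lev a := (dd x (ev a)).

Lemma sum_ev (M : nmodType) (F : X -> M) : \sum_(a < #|X|) F (ev a) = \sum_w F w.
Proof. by rewrite -big_enum_val. Qed.

Lemma dual_mulE i (u : V) a : (Ed i *m u) a 0 = if lev a == i then u a 0 else 0.
Proof.
rewrite mxE (bigD1 a) //= big1 ?addr0 => [|b ba]; rewrite mxE.
  by rewrite eqxx; case: eqP; rewrite ?mul1r ?mul0r.
by rewrite eq_sym (negPf ba) mul0r.
Qed.

Lemma dist_mulE i (u : V) a :
  (dist_mx R e i *m u) a 0 = \sum_b (dd (ev a) (ev b) == i)%:R * u b 0.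
Proof. by rewrite mxE; apply: eq_bigr => b _; rewrite mxE. Qed.

Lemma dual_adj i (u w : V) : herm (Ed i *m u) w = herm u (Ed i *m w).
Proof.
apply: herm_adj => a b; rewrite !mxE conjC_nat eq_sym; congr (_ %:R).
by congr nat_of_bool; case: eqP => // ->.
Qed.

Lemma dist_adj i (u w : V) : herm (dist_mx R e i *m u) w = herm u (dist_mx R e i *m w).
Proof. by apply: herm_adj => a b; rewrite !mxE conjC_nat gdist_sym. Qed.

Lemma dual_mulK i (u : V) : Ed i *m (Ed i *m u) = Ed i *m u.
Proof. by apply/colP => a; rewrite !dual_mulE; case: eqP. Qed.

Lemma dual_mul_neq i j (u : V) : i != j -> Ed i *m (Ed j *m u) = 0.
Proof.
move=> ij; apply/colP => a; rewrite !dual_mulE [RHS]mxE.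
by case: eqP => // ->; rewrite (negPf ij).
Qed.

Lemma dual_diameter i (u : V) : (D < i)%N -> Ed i *m u = 0.
Proof.
move=> Di; apply/colP => a; rewrite dual_mulE [RHS]mxE.
by have := gdist_diameter e x (ev a); case: eqP => // ->; lia.
Qed.

(* As c varies, these matrices form the Bose-Mesner algebra. *)
Definition dist_fun_mx (c : nat -> C) : 'M[C]_#|X| :=
  \matrix_(a < #|X|, b < #|X|) c (dd (enum_val a) (enum_val b)).

Lemma dist_fun_mul_vec c (u : V) a :
  (dist_fun_mx c *m u) a (0 : 'I_1) = \sum_b c (dd (ev a) (ev b)) * u b 0.
Proof. by rewrite mxE; apply: eq_bigr => b _; rewrite mxE. Qed.

Lemma dist_fun_mxB b c c' :
  dist_fun_mx c - b *: dist_fun_mx c' = dist_fun_mx (fun h => c h - b * c' h).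
Proof. by apply/matrixP => i j; rewrite !mxE. Qed.

Section Bipartite.
Hypothesis e_bip : bipartite e.

(** In a bipartite graph the neighbours of a vertex at level i lie at levels i - 1 and i + 1. At i =
    0 there is no lower level, and the factor removes that term. *)
Lemma adj_level_split i (u : V) : Ed i *m u = u ->
  Aj *m u = Ed i.+1 *m (Aj *m u) + (0 < i)%:R *: (Ed i.-1 *m (Aj *m u)).
Proof.
move=> uE; apply/colP => a; rewrite [RHS]mxE [X in _ + X]mxE !dual_mulE.
have [->|ai1] := eqVneq (lev a) i.+1.
  by case: eqP => [|_]; [lia|rewrite mulr0 addr0].
rewrite add0r; case: (eqVneq (lev a) i.-1) => [ai|ai].
  case: i uE ai1 ai => [|i] uE ai1 ai; last by rewrite mul1r.
  rewrite mul0r dist_mulE big1 // => b _; rewrite -uE dual_mulE.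
  have [eab|] := eqVneq (dd (ev a) (ev b)) 1%N; last by rewrite mul0r.
  case: eqP => [b0|]; last by rewrite mulr0.
  move/eqP: eab; rewrite (gdist_eq1 e_irr) // => /(gdist_adj e_sym e_irr e_conn e_bip x).
  by rewrite b0 ai /=; lia.
rewrite mulr0 dist_mulE big1 // => b _; rewrite -uE dual_mulE.
have [eab|] := eqVneq (dd (ev a) (ev b)) 1%N; last by rewrite mul0r.
case: eqP => [b0|]; last by rewrite mulr0.
move/eqP: eab; rewrite (gdist_eq1 e_irr) // => /(gdist_adj e_sym e_irr e_conn e_bip x).
by rewrite b0; lia.
Qed.

End Bipartite.

Section Regular.
Hypothesis e_dreg : distance_regular e.

(** This is the recurrence A A_j = sum over h of p^h_{1j} A_h: the Bose-Mesner algebra is closed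
    under multiplication by A. *)
Lemma adj_dist_fun_mul c : exists c', Aj *m dist_fun_mx c = dist_fun_mx c'.
Proof.
exists (fun h => \sum_(j < D.+1) c j * (inter_num e h 1 j)%:R).
apply/matrixP => a b; rewrite !mxE.
pose z := ev b; pose y := ev a.
transitivity (\sum_w (dd y w == 1%N)%:R * c (dd w z)).
  by rewrite -sum_ev; apply: eq_bigr => d _; rewrite !mxE.
transitivity (\sum_w \sum_(j < D.+1) c j * ((dd y w == 1%N) && (dd w z == j))%:R).
  apply: eq_bigr => w _; have wz := gdist_diameter e w z.
  rewrite (bigD1 (inord (dd w z))) //= inordK // eqxx andbT mulrC big1 ?addr0 //.
  move=> j jwz; case: (dd w z =P j) => [wzj|]; last by rewrite andbF mulr0.
  by rewrite wzj inord_val eqxx in jwz.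
rewrite exchange_big; apply: eq_bigr => j _ /=; rewrite -mulr_sumr; congr (_ * _).
rewrite (inter_numE e_dreg 1 j (erefl (dd y z))) -sum1_card natr_sum [RHS]big_mkcond.
apply: eq_bigr => w _; rewrite !inE (gdist_sym e_sym e_conn z w).
by case: ifP.
Qed.

(** Double counting of edges between levels 1 and 2: every vertex at level 2 has c_2 neighbours at
    level 1, so the entries of E*_1 A u add up to c_2 times the sum of u, and c_2 is positive. *)
Lemma sum0_level2 (u : V) : (2 <= D)%N ->
  Ed 2 *m u = u -> Ed 1 *m (Aj *m u) = 0 -> \sum_a u a 0 = 0.
Proof.
move=> D2 uE Au.
have c2 := inter_num_2_1_1_gt0 e_sym e_irr e_conn e_dreg D2.
apply/(mulfI (_ : (inter_num e 2 1 1)%:R != 0)); first by rewrite pnatr_eq0 -lt0n.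
rewrite mulr0 mulr_sumr.
transitivity (\sum_a (Ed 1 *m (Aj *m u)) a 0); last first.
  by rewrite Au big1 // => a _; rewrite mxE.
under [RHS]eq_bigr do rewrite dual_mulE dist_mulE.
rewrite -[RHS]big_mkcond /= exchange_big; apply: eq_bigr => b _ /=.
rewrite -mulr_suml; have := dual_mulE 2 u b; rewrite uE.
case: eqP => [lb _|_ ->]; last by rewrite !mulr0.
congr (_ * _); rewrite (inter_numE e_dreg 1 1 lb) -sum1_card natr_sum.
rewrite big_mkcond [RHS]big_mkcond /= -(sum_ev (fun w => if w \in _ then _ else _)).
apply: eq_bigr => a _; rewrite !inE (gdist_sym e_sym e_conn (ev b)).
by case: eqP; case: eqP.
Qed.

(* E*_2 A_j E*_2 acts on such u as 1, eta, -(1 + eta) for j = 0, 2, 4 and as 0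
   for all other j. *)
Lemma dist_fun_level2 c eta (u : V) : bipartite e ->
  Ed 2 *m u = u -> \sum_a u a 0 = 0 ->
  Ed 2 *m dist_mx R e 2 *m Ed 2 *m u = eta *: u ->
  Ed 2 *m (dist_fun_mx c *m u) = ((c 0%N - c 4%N) + (c 2%N - c 4%N) * eta) *: u.
Proof.
move=> e_bip uE u0; rewrite -!mulmxA uE => ueta; apply/colP => a.
rewrite dual_mulE [RHS]mxE; have := dual_mulE 2 u a; rewrite uE.
case: eqP => [la _|_ ->]; last by rewrite mulr0.
have {}ueta : \sum_b (dd (ev a) (ev b) == 2%N)%:R * u b 0 = eta * u a 0.
  by rewrite -dist_mulE; move/colP/(_ a): ueta; rewrite dual_mulE la eqxx => ->;
    rewrite mxE.
rewrite dist_fun_mul_vec mulrDl -mulrA -ueta.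
(* Two vertices at level 2 are at distance 0, 2 or 4. Hence c equals the constant c 4, corrected at
   distances 0 and 2; the constant contributes nothing because the entries of u sum to 0. *)
transitivity (\sum_b (c 4%N * u b 0 + (c 0%N - c 4%N) * ((a == b)%:R * u b 0) +
   (c 2%N - c 4%N) * ((dd (ev a) (ev b) == 2%N)%:R * u b 0))).
  apply: eq_bigr => b _; have := dual_mulE 2 u b; rewrite uE.
  case: eqP => [lb _|_ ->]; last by rewrite !mulr0 !addr0.
  have := gdist_triangle e_conn x (ev a) (ev b).
  have := gdist_parity e_conn e_bip (ev a) x (ev b).
  rewrite -(inj_eq enum_val_inj a b) -(gdist_eq0 e_conn).
  rewrite (gdist_sym e_sym e_conn (ev a) x) la lb.
  move: (dd (ev a) (ev b)) => [|[|[|[|[|n]]]]] //= _ _;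
    rewrite ?mul0r ?mul1r ?mulr0 ?addr0 //.
    by rewrite mulrBl addrC subrK.
  by rewrite mulrBl addrC subrK.
rewrite !big_split /= -!mulr_sumr u0 mulr0 add0r; congr (_ * _ + _).
rewrite (bigD1 a) //= eqxx mul1r big1 ?addr0 // => b ba.
by rewrite eq_sym (negPf ba) mul0r.
Qed.

End Regular.
End Vectors.

(** * Raising vectors of a thin module *)

Section Modules.
Variables (R : realType) (X : finType) (e : rel X) (x : X).

Local Notation C := R[i].
Local Notation V := 'cV[C]_#|X|.
Local Notation dd := (gdist e).
Local Notation D := (diameter e).
Local Notation Aj := (dist_mx R e 1).
Local Notation Ed i := (dual_idem R e x i).
Local Notation Tmod := (@Tmodule R X e x).
Implicit Types W U : {vspace V}.

Lemma mximgP (B : 'M[C]_#|X|) W w :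
  reflect (exists2 u, u \in W & w = B *m u) (w \in mximg B W).
Proof.
apply: (iffP memv_imgP) => [[u uW ->]|[u uW ->]]; exists u => //; by rewrite lfunE.
Qed.

Lemma mximg_sub (B : 'M[C]_#|X|) U W :
  (forall u, u \in U -> B *m u \in W) -> (mximg B U <= W)%VS.
Proof. by move=> BU; apply/subvP => _ /mximgP[u uU ->]; apply: BU. Qed.

Lemma Tmodule_dual W i w : Tmod W -> w \in W -> Ed i *m w \in W.
Proof.
move=> mW wW; case: (leqP i D) => iD; first by apply: mW => //; apply: inT_dual.
by rewrite dual_diameter // mem0v.
Qed.

Lemma dual_subP W i w : Tmod W ->
  reflect (w \in W /\ Ed i *m w = w) (w \in mximg (Ed i) W).
Proof.
move=> mW; apply: (iffP (mximgP _ _ _)) => [[u uW ->]|[wW wE]].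
  by rewrite dual_mulK Tmodule_dual.
by exists w.
Qed.

Lemma TmoduleP W : (forall w, w \in W -> Aj *m w \in W) ->
  (forall i w, w \in W -> Ed i *m w \in W) -> Tmod W.
Proof.
move=> WA WE B w TB.
elim: TB w => {B} [|i _||B B' _ IH _ IH'|a B _ IH|B B' _ IH _ IH'] w wW.
- exact: WA.
- exact: WE.
- by rewrite mul1mx.
- by rewrite mulmxDl memvD ?IH ?IH'.
- by rewrite -scalemxAl memvZ ?IH.
- by rewrite -mulmxA IH ?IH'.
Qed.

Lemma endpoint2 W : (2 <= D)%N -> endpoint e x W = 2%N ->
  mximg (Ed 1) W = 0%VS /\ mximg (Ed 2) W != 0%VS.
Proof.
move=> D2 W2; split.
  have := @before_find _ 0%N (fun i => mximg (Ed i) W != 0%VS) (iota 0 D.+1) 1.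
  rewrite -/(endpoint e x W) W2 nth_iota; last exact: ltnW.
  by move/(_ isT)/negbFE/eqP.
have hW : has (fun i => mximg (Ed i) W != 0%VS) (iota 0 D.+1).
  by rewrite has_find size_iota -/(endpoint e x W) W2.
by have := nth_find 0%N hW; rewrite -/(endpoint e x W) W2 nth_iota //; apply: ltnW.
Qed.

Lemma eq_endpoint U W :
  (forall i, (i <= D)%N -> \dim (mximg (Ed i) U) = \dim (mximg (Ed i) W)) ->
  endpoint e x U = endpoint e x W.
Proof.
move=> UW; apply: eq_in_find => i; rewrite mem_iota ltnS => /andP[_ iD] /=.
by rewrite -!dimv_eq0 UW.
Qed.

(** The index is shifted by the endpoint: the n-th vector lives at level n + 2. *)
Fixpoint raise (v : V) n : V :=
  if n is m.+1 then Ed m.+3 *m (Aj *m raise v m) else v.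

Lemma raise_mem W v n : Tmod W -> v \in W -> raise v n \in W.
Proof.
move=> mW vW; elim: n => //= n IH; apply: Tmodule_dual => //.
by apply: mW => //; apply: inT_adj.
Qed.

Lemma raise_level v n : Ed 2 *m v = v -> Ed n.+2 *m raise v n = raise v n.
Proof. by case: n => //= n _; rewrite dual_mulK. Qed.

Lemma raise_diameter v n : Ed 2 *m v = v -> (D < n.+2)%N -> raise v n = 0.
Proof. by move=> v2 Dn; rewrite -raise_level // dual_diameter. Qed.

Section Graph.
Hypothesis e_sym : symmetric e.
Hypothesis e_irr : irreflexive e.
Hypothesis e_conn : forall y z : X, connect e y z.
Hypothesis e_bip : bipartite e.
Hypothesis e_dreg : distance_regular e.
Hypothesis D_ge2 : (2 <= D)%N.

Lemma adj_pow_level (v : V) n a : Ed 2 *m v = v ->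
  (n.+2 < dd x (enum_val a))%N -> iter n (mulmx Aj) v a 0 = 0.
Proof.
move=> v2; elim: n a => [|n IH] a la.
  by rewrite -v2 dual_mulE; case: eqP => // l2; rewrite l2 in la.
rewrite iterS dist_mulE big1 // => b _.
have [ab|] := eqVneq; last by rewrite mul0r.
rewrite IH ?mulr0 //; have := gdist_triangle e_conn (enum_val b) x (enum_val a).
by rewrite (gdist_sym e_sym e_conn (enum_val b)) ab; lia.
Qed.

Lemma raise_pow (v : V) n : Ed 2 *m v = v ->
  raise v n = Ed n.+2 *m iter n (mulmx Aj) v.
Proof.
move=> v2; elim: n => [|n IH] //=; rewrite IH; apply/colP => a.
rewrite !dual_mulE; case: eqP => // la; rewrite !dist_mulE.
apply: eq_bigr => b _; have [ab|] := eqVneq; last by rewrite !mul0r.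
rewrite dual_mulE; case: eqP => // lb; rewrite adj_pow_level //.
have := gdist_triangle e_conn (enum_val b) x (enum_val a).
rewrite (gdist_sym e_sym e_conn (enum_val b)) ab la.
by move/eqP: lb; move: (dd x (enum_val b)) => m; lia.
Qed.

(** The order of the quantifiers matters: [c'] serves all vectors v at once. *)
Lemma adj_pow_dist_fun c n :
  exists c', forall v : V,
    iter n (mulmx Aj) (dist_fun_mx e c *m v) = dist_fun_mx e c' *m v.
Proof.
elim: n => [|n [c' IH]]; first by exists c.
have [c'' E] := adj_dist_fun_mul e_sym e_conn e_dreg c'.
by exists c'' => v; rewrite iterS IH mulmxA E.
Qed.

Lemma adj_raise0 (v : V) : Ed 2 *m v = v -> Ed 1 *m (Aj *m v) = 0 ->
  Aj *m raise v 0 = raise v 1.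
Proof.
move=> v2 v1; rewrite (adj_level_split e_sym e_irr e_conn e_bip v2) /= v1.
by rewrite scaler0 addr0.
Qed.

Lemma adj_raiseS (v : V) n : Ed 2 *m v = v ->
  Aj *m raise v n.+1 = raise v n.+2 + Ed n.+2 *m (Aj *m raise v n.+1).
Proof.
move=> v2.
have := adj_level_split e_sym e_irr e_conn e_bip (raise_level n.+1 v2).
by rewrite scale1r.
Qed.

(** These are the properties of a vector in E*_2 W that are used for a module W with endpoint 2. The
    middle one reflects E*_1 W = 0 and forces the entries of v to sum to 0. All three are linear in
    v. *)
Definition local_vector eta (v : V) :=
  [/\ Ed 2 *m v = v, Ed 1 *m (Aj *m v) = 0 &
      Ed 2 *m dist_mx R e 2 *m Ed 2 *m v = eta *: v].

(** With r_n = B v for B in the Bose-Mesner algebra, the squared norm is the product of A^n v and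
    r_n, hence of v and E*_2 A^n B v. By [dist_fun_level2] the latter is a multiple of v whose
    factor depends only on [c], n and [eta]. *)
Lemma raise_norm n c eta : exists N, forall v, local_vector eta v ->
  dist_fun_mx e c *m v = raise v n -> herm (raise v n) (raise v n) = N * herm v v.
Proof.
have [c' cE] := adj_pow_dist_fun c n.
(* The conjugate appears because [herm] is conjugate-linear in its second argument. *)
pose N := ((c' 0%N - c' 4%N) + (c' 2%N - c' 4%N) * eta)^*.
exists N => v [v2 v1 veta] rn.
rewrite {1}raise_pow // dual_adj raise_level //.
have -> m w : herm (iter m (mulmx Aj) v) w = herm v (iter m (mulmx Aj) w).
  by elim: m w => [|m IH] w //; rewrite iterS iterSr dist_adj // IH.
rewrite -{1}v2 dual_adj -rn cE (dist_fun_level2 e_sym e_conn c' e_bip v2 _ veta).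
  by rewrite hermZr.
by apply: (sum0_level2 e_sym e_irr e_conn e_dreg D_ge2 v2 v1).
Qed.

(** Lowering is adjoint to raising, so a lowering coefficient is a ratio of consecutive squared
    norms. *)
Lemma raise_normS (v : V) n : Ed 2 *m v = v ->
  herm (raise v n.+1) (raise v n.+1) =
  herm (Ed n.+2 *m (Aj *m raise v n.+1)) (raise v n).
Proof.
move=> v2; rewrite dual_adj raise_level // [in RHS]dist_adj //.
by rewrite -[in RHS](raise_level n.+1 v2) dual_adj.
Qed.

(** By thinness r_n spans E*_{n+2} W unless it is zero; in that case r_{n+1} is zero too. *)
Lemma lower_raise_span W v n : Tmod W -> thin e x W -> v \in W -> Ed 2 *m v = v ->
  exists b, Ed n.+2 *m (Aj *m raise v n.+1) = b *: raise v n.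
Proof.
move=> mW tW vW v2; have [rn|rn] := eqVneq (raise v n) 0.
  by exists 0; rewrite /= rn !(mulmx0, scaler0).
have nD : (n.+2 <= D)%N.
  by rewrite leqNgt; apply: contraNN rn => /(raise_diameter v2) ->.
apply: (vlineW (tW _ nD)) => //.
  by apply/mximgP; exists (raise v n); [exact: raise_mem|rewrite raise_level].
apply/mximgP; exists (Ed n.+2 *m (Aj *m raise v n.+1)); last exact/esym/dual_mulK.
apply: Tmodule_dual => //; apply: (mW); [exact: inT_adj|exact: raise_mem].
Qed.

(** * Two modules with the same local eigenvalue *)

Section Pair.
Variables (eta : C) (W W' : {vspace V}) (v v' : V).
Hypotheses (mW : Tmod W) (mW' : Tmod W').
Hypotheses (tW : thin e x W) (tW' : thin e x W').
Hypotheses (vW : v \in W) (v'W' : v' \in W').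
Hypotheses (lv : local_vector eta v) (lv' : local_vector eta v').
Hypotheses (v0 : v != 0) (v'0 : v' != 0).

Let v2 : Ed 2 *m v = v. Proof. by case: lv. Qed.
Let v'2 : Ed 2 *m v' = v'. Proof. by case: lv'. Qed.

(** A single element of the Bose-Mesner algebra must produce both raised vectors; this is the
    induction invariant that makes their norms comparable. *)
Definition same_dist_fun n :=
  exists c, dist_fun_mx e c *m v = raise v n /\ dist_fun_mx e c *m v' = raise v' n.

Lemma same_norm n : same_dist_fun n -> exists N,
  herm (raise v n) (raise v n) = N * herm v v /\
  herm (raise v' n) (raise v' n) = N * herm v' v'.
Proof.
by case=> c [cv cv']; have [N Nv] := raise_norm n c eta; exists N; rewrite !Nv.
Qed.

Lemma same_raise0 n : same_dist_fun n -> (raise v n == 0) = (raise v' n == 0).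
Proof.
move/same_norm=> [N [Nv Nv']]; rewrite -!herm_eq0 Nv Nv' !mulf_eq0 !herm_eq0.
by rewrite (negPf v0) (negPf v'0).
Qed.

(** Both lowering coefficients equal M / N, where N and M are the common norm factors at n and n +
    1. If r_n vanishes for one vector, it does for the other, and b = 0 serves. *)
Lemma same_lower n : same_dist_fun n -> same_dist_fun n.+1 -> exists b,
  Ed n.+2 *m (Aj *m raise v n.+1) = b *: raise v n /\
  Ed n.+2 *m (Aj *m raise v' n.+1) = b *: raise v' n.
Proof.
move=> sn sn1; have [rn|rn] := eqVneq (raise v n) 0.
  have /eqP rn' : raise v' n == 0 by rewrite -same_raise0 ?rn.
  by exists 0; rewrite /= rn rn' !(mulmx0, scaler0).
have rn' : raise v' n != 0 by rewrite -same_raise0.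
have [b bv] := lower_raise_span n mW tW vW v2.
have [b' bv'] := lower_raise_span n mW' tW' v'W' v'2.
exists b; split=> //; rewrite bv'; congr (_ *: _).
have [N [Nv Nv']] := same_norm sn; have [M [Mv Mv']] := same_norm sn1.
have vv : herm v v != 0 by rewrite herm_eq0.
have vv' : herm v' v' != 0 by rewrite herm_eq0.
have N0 : N != 0.
  by move: rn; rewrite -herm_eq0 Nv; apply: contraNneq => ->; rewrite mul0r.
apply: (mulIf N0); transitivity M.
  apply: (mulIf vv'); rewrite -Mv' -mulrA -Nv'; have := raise_normS n v'2.
  by rewrite bv' hermZl => ->.
apply: (mulIf vv); rewrite -Mv -mulrA -Nv; have := raise_normS n v2.
by rewrite bv hermZl => ->.
Qed.

(** The recurrence r_{n+2} = A r_{n+1} - b r_n, with the same b on both sides, keeps the invariant.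
    It needs two consecutive indices, which the induction therefore carries. *)
Lemma same_raise n : same_dist_fun n.
Proof.
suff : same_dist_fun n /\ same_dist_fun n.+1 by case.
elim: n => [|n [sn sn1]].
  pose c0 h : C := (h == 0%N)%:R.
  have c0E (w : V) : dist_fun_mx e c0 *m w = w.
    apply/colP => a; rewrite dist_fun_mul_vec (bigD1 a) //= big1 => [|b ba].
      by rewrite /c0 (gdist_eq0 e_conn) eqxx mul1r addr0.
    by rewrite /c0 (gdist_eq0 e_conn) (inj_eq enum_val_inj) eq_sym (negPf ba) mul0r.
  split; first by exists c0; rewrite !c0E.
  have [c1 cE] := adj_dist_fun_mul e_sym e_conn e_dreg c0.
  have [[_ v1 _] [_ v'1 _]] := (lv, lv').
  by exists c1; rewrite -cE -!mulmxA !c0E -!adj_raise0.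
split=> //; have [b [bv bv']] := same_lower sn sn1.
have [[c [cv cv']] [d [dv dv']]] := (sn, sn1).
have [d1 dE] := adj_dist_fun_mul e_sym e_conn e_dreg d.
exists (fun h => d1 h - b * c h).
have := adj_raiseS n v2; have := adj_raiseS n v'2; rewrite bv bv' => Av' Av.
rewrite -dist_fun_mxB -dE !mulmxBl -!scalemxAl -!mulmxA cv cv' dv dv' Av Av'.
by rewrite !addrK.
Qed.

End Pair.

End Graph.
End Modules.

(** * Isomorphism of thin modules with endpoint 2 *)

Section Isomorphism.
Variables (R : realType) (X : finType) (e : rel X) (x : X).

Local Notation C := R[i].
Local Notation V := 'cV[C]_#|X|.
Local Notation D := (diameter e).
Local Notation Aj := (dist_mx R e 1).
Local Notation Ed i := (dual_idem R e x i).
Local Notation Tmod := (@Tmodule R X e x).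
Local Notation Tirr := (@Tirreducible R X e x).
Local Notation Tiso := (@Tisomorphic R X e x).
Local Notation rz := (raise e x).
Implicit Types W U : {vspace V}.

Lemma Tmodule_dist1 W w : Tmod W -> w \in W -> Aj *m w \in W.
Proof. by move=> mW; apply: mW; apply: inT_adj. Qed.

Lemma Thom_gen W (f : 'End(V)) : Tmod W ->
  (forall w, w \in W -> f (Aj *m w) = Aj *m f w) ->
  (forall i w, w \in W -> f (Ed i *m w) = Ed i *m f w) ->
  forall B w, inT e x B -> w \in W -> f (B *m w) = B *m f w.
Proof.
move=> mW fA fE B w TB.
elim: TB w => {B} [|i _||B B' _ IH _ IH'|a B _ IH|B B' TB IH TB' IH'] w wW.
- exact: fA.
- exact: fE.
- by rewrite !mul1mx.
- by rewrite !mulmxDl linearD /= IH ?IH'.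
- by rewrite -!scalemxAl linearZ /= IH.
- by rewrite -!mulmxA IH ?IH' //; apply: mW.
Qed.

(** Schur's lemma: the image is a nonzero submodule of W', hence all of it, and the kernel in W is a
    proper submodule, hence zero. *)
Lemma Thom_iso W W' (f : 'End(V)) w : Tirr W -> Tirr W' ->
  (forall u, u \in W -> f u \in W') ->
  (forall B u, inT e x B -> u \in W -> f (B *m u) = B *m f u) ->
  w \in W -> f w != 0 -> Tiso W W'.
Proof.
move=> [mW W0 irrW] [mW' W'0 irrW'] fW fT wW fw; exists f; split=> //.
  have [||f0|//] := irrW' (f @: W)%VS.
  - by move=> B _ TB /memv_imgP[u uW ->]; rewrite -fT // memv_img // mW.
  - by apply/subvP => _ /memv_imgP[u uW ->]; apply: fW.
  - by have := memv_img f wW; rewrite f0 memv0 (negPf fw).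
have [||//|kerW] := irrW (W :&: lker f)%VS.
- move=> B u TB; rewrite !memv_cap !memv_ker => /andP[uW /eqP fu].
  by rewrite fT // fu mulmx0 eqxx andbT mW.
- exact: capvSl.
- by move: wW; rewrite -kerW memv_cap memv_ker (negPf fw) andbF.
Qed.

Lemma Tiso_dim U W i : Tmod U -> Tiso U W -> (i <= D)%N ->
  \dim (mximg (Ed i) U) = \dim (mximg (Ed i) W).
Proof.
move=> mU [f [fU kerf fT]] iD.
have -> : mximg (Ed i) W = (f @: mximg (Ed i) U)%VS.
  apply/vspaceP => w; apply/mximgP/memv_imgP => [[w']|].
    rewrite -fU => /memv_imgP[u uU ->] ->.
    exists (Ed i *m u); first by apply/mximgP; exists u.
    by rewrite fT //; apply: inT_dual.
  case=> _ /mximgP[u uU ->] ->; exists (f u); first by rewrite -fU memv_img.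
  by rewrite fT //; apply: inT_dual.
rewrite [RHS]limg_dim_eq //; apply: subv_anti.
rewrite sub0v andbT -[X in (_ <= X)%VS]kerf capvS //.
by apply: mximg_sub => u uU; apply: Tmodule_dual.
Qed.

(** The cut-off at D loses nothing, since the later vectors would lie beyond the diameter and
    vanish. *)
Definition rspan (v : V) : {vspace V} := <<[seq rz v n | n <- iota 0 D]>>%VS.

Lemma mem_rspan v n : Ed 2 *m v = v -> rz v n \in rspan v.
Proof.
move=> v2; case: (ltnP n D) => nD; last by rewrite raise_diameter ?mem0v // ltnS ltnW.
by apply: memv_span; apply/mapP; exists n; rewrite ?mem_iota.
Qed.

Lemma mulmx_rspan B v W : (forall n, B *m rz v n \in W) ->
  forall w, w \in rspan v -> B *m w \in W.
Proof.
move=> BW w /(memv_img (linfun (mulmx B : V -> V))); rewrite lfunE /= => wB.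
apply: subvP wB; rewrite limg_span; apply/span_subvP => _ /mapP[_ /mapP[n _ ->] ->].
by rewrite lfunE; apply: BW.
Qed.

Lemma eq_on_rspan (f g : 'End(V)) v : (forall n, f (rz v n) = g (rz v n)) ->
  forall w, w \in rspan v -> f w = g w.
Proof.
move=> fg; apply/span_lfunP => _ /mapP[n _ ->]; exact: fg.
Qed.

Section Graph.
Hypothesis e_sym : symmetric e.
Hypothesis e_irr : irreflexive e.
Hypothesis e_conn : forall y z : X, connect e y z.
Hypothesis e_bip : bipartite e.
Hypothesis e_dreg : distance_regular e.
Hypothesis D_ge2 : (2 <= D)%N.

Lemma adj_raise W v eta n : Tmod W -> thin e x W -> v \in W ->
  local_vector e x eta v ->
  exists b, Aj *m rz v n = rz v n.+1 + b *: rz v n.-1.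
Proof.
move=> mW tW vW [v2 v1 _]; case: n => [|n].
  by exists 0; rewrite adj_raise0 // scale0r addr0.
have [b bv] := lower_raise_span n mW tW vW v2.
by exists b; rewrite -bv -adj_raiseS.
Qed.

Lemma dual_raise v i n : Ed 2 *m v = v ->
  Ed i *m rz v n = (i == n.+2)%:R *: rz v n.
Proof.
move=> v2; have [->|inn] := eqVneq; first by rewrite scale1r raise_level.
by rewrite scale0r -(raise_level n v2) dual_mul_neq.
Qed.

Lemma rspan_Tmodule W v eta : Tmod W -> thin e x W -> v \in W ->
  local_vector e x eta v -> Tmod (rspan v).
Proof.
move=> mW tW vW lv; have [v2 _ _] := lv.
apply: TmoduleP => [|i]; apply: mulmx_rspan => n.
  by have [b ->] := adj_raise n mW tW vW lv; rewrite memvD ?memvZ ?mem_rspan.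
by rewrite dual_raise // memvZ ?mem_rspan.
Qed.

Lemma rspan_irreducible W v eta : Tirr W -> thin e x W -> v \in W -> v != 0 ->
  local_vector e x eta v -> rspan v = W.
Proof.
move=> [mW W0 irrW] tW vW v0 lv; have [v2 _ _] := lv.
case: (irrW (rspan v)) => //.
- exact: rspan_Tmodule mW tW vW lv.
- by apply/span_subvP => _ /mapP[n _ ->]; apply: raise_mem.
- move=> Z0; have : v \in rspan v by apply: (mem_rspan 0 v2).
  by rewrite Z0 memv0 (negPf v0).
Qed.

Lemma thin_endpoint2_vector eta W : thin_endpoint2 e x eta W ->
  exists v, [/\ v \in W, v != 0 & local_vector e x (eta%:C)%C v].
Proof.
case=> [[mW W0 irrW] tW W2 [v [vE v0 veta]]].
have [E1W _] := endpoint2 D_ge2 W2.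
have /(dual_subP _ _ mW)[vW v2] := vE.
exists v; split=> //; split=> //; apply/eqP; rewrite -memv0 -E1W.
by apply/mximgP; exists (Aj *m v) => //; apply: Tmodule_dist1.
Qed.

(** The vectors r_n of v lie at distinct levels and are thus orthogonal, so this operator sends each
    of them to the corresponding vector of v'. A vanishing r_n contributes zero. *)
Definition raise_map (v v' : V) : 'M[C]_#|X| :=
  \sum_(n < D) (herm (rz v n) (rz v n))^-1 *:
     (rz v' n *m (map_mx Num.conj (rz v n))^T).

Lemma raise_mapE v v' w : raise_map v v' *m w =
  \sum_(n < D) ((herm (rz v n) (rz v n))^-1 * herm w (rz v n)) *: rz v' n.
Proof.
rewrite /raise_map mulmx_suml; apply: eq_bigr => n _.
by rewrite -scalemxAl outer_mul scalerA.
Qed.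

Lemma raise_map_raise v v' n : Ed 2 *m v = v -> Ed 2 *m v' = v' ->
  (rz v n == 0) = (rz v' n == 0) -> raise_map v v' *m rz v n = rz v' n.
Proof.
move=> v2 v'2 r0; rewrite raise_mapE.
case: (ltnP n D) => nD; last first.
  rewrite !raise_diameter //; try exact: ltnW.
  by rewrite big1 // => i _; rewrite herm0l mulr0 scale0r.
rewrite (bigD1 (Ordinal nD)) //= big1 ?addr0 => [|i ni].
  have [rn|rn] := eqVneq (rz v n) 0; last by rewrite mulVf ?herm_eq0 // scale1r.
  by move: r0; rewrite rn eqxx => /esym/eqP ->; rewrite scaler0.
suff -> : herm (rz v n) (rz v i) = 0 by rewrite mulr0 scale0r.
rewrite -(raise_level n v2) dual_adj dual_raise //.
case: eqP => [[ni']|_]; last by rewrite scale0r herm_sym0 ?herm0l.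
by case/eqP: ni; apply: val_inj; rewrite /= ni'.
Qed.

Lemma thin_endpoint2_iso eta W W' :
  thin_endpoint2 e x eta W -> thin_endpoint2 e x eta W' -> Tiso W W'.
Proof.
move=> tW tW'; have [v [vW v0 lv]] := thin_endpoint2_vector tW.
have [v' [v'W' v'0 lv']] := thin_endpoint2_vector tW'.
have [[iW thW _ _] [iW' thW' _ _]] := (tW, tW').
have [[mW _ _] [mW' _ _]] := (iW, iW').
have [[v2 v1 _] [v'2 v'1 _]] := (lv, lv').
pose f : 'End(V) := linfun (mulmx (raise_map v v')).
have sn n : same_dist_fun e x v v' n.
  exact: (same_raise e_sym e_irr e_conn e_bip e_dreg D_ge2 mW mW' thW thW' vW v'W' lv lv').
have fr n : f (rz v n) = rz v' n.
  rewrite lfunE /= raise_map_raise //.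
  exact: (same_raise0 e_sym e_irr e_conn e_bip e_dreg D_ge2 lv lv' v0 v'0 (sn n)).
have sW : rspan v = W := rspan_irreducible iW thW vW v0 lv.
(* Since the raised vectors span W, commuting with B need only be checked on them. *)
have comm B : (forall n, f (B *m rz v n) = B *m f (rz v n)) ->
    forall w, w \in W -> f (B *m w) = B *m f w.
  move=> fB w; rewrite -sW => wv; pose b := linfun (mulmx B : V -> V).
  have := @eq_on_rspan (f \o b)%VF (b \o f)%VF v _ w wv.
  rewrite !comp_lfunE !(lfunE (mulmx B)) /=; apply=> n.
  by rewrite !comp_lfunE !(lfunE (mulmx B)) /=.
apply: (@Thom_iso W W' f v) => //; last by rewrite (fr 0).
  move=> u; rewrite -sW lfunE /=; apply: mulmx_rspan => n.
  by rewrite -(lfunE (mulmx (raise_map v v'))) fr raise_mem.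
apply: Thom_gen => // [|i]; apply: comm => n; rewrite !fr; last first.
  by rewrite !dual_raise // linearZ /= fr.
case: n => [|n]; first by rewrite !adj_raise0 // fr.
(* The equality of the lowering coefficients is what makes f commute with A. *)
have [b [bv bv']] := same_lower e_sym e_irr e_conn e_bip e_dreg D_ge2
  mW mW' thW thW' vW v'W' lv lv' v0 v'0 (sn n) (sn n.+1).
have := adj_raiseS e_sym e_irr e_conn e_bip n v2; rewrite bv => ->.
have := adj_raiseS e_sym e_irr e_conn e_bip n v'2; rewrite bv' => ->.
have fD c u w : f (u + c *: w) = f u + c *: f w by rewrite linearD linearZ.
by rewrite fD !fr.
Qed.

End Graph.
End Isomorphism.

(** * Orthogonal decompositions *)

Section Decomposition.
Variables (R : realType) (X : finType) (e : rel X) (x : X).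
Hypothesis e_sym : symmetric e.
Hypothesis e_irr : irreflexive e.
Hypothesis e_conn : forall y z : X, connect e y z.

Local Notation C := R[i].
Local Notation V := 'cV[C]_#|X|.
Local Notation D := (diameter e).
Local Notation dd := (gdist e).
Local Notation Aj := (dist_mx R e 1).
Local Notation Ed i := (dual_idem R e x i).
Local Notation Tmod := (@Tmodule R X e x).
Local Notation Tirr := (@Tirreducible R X e x).
Local Notation Tiso := (@Tisomorphic R X e x).
Local Notation orth := (@orthogonal_sub R X).
Implicit Types W U : {vspace V}.

(** The positive semidefinite operator taking w to the sum of [herm w b *: b] over a basis of U. Its
    kernel is the orthogonal complement, which so becomes a subspace without further proof. *)
Definition gram_map U : 'End(V) :=
  linfun (mulmx (\sum_(b <- vbasis U) b *m (map_mx Num.conj b)^T) : V -> V).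

Lemma gram_mapE U w : gram_map U w = \sum_(b <- vbasis U) herm w b *: b.
Proof.
rewrite lfunE /= mulmx_suml; apply: eq_bigr => b _; exact: outer_mul.
Qed.

Definition perp U : {vspace V} := lker (gram_map U).

Lemma perpP U w : reflect (forall u, u \in U -> herm w u = 0) (w \in perp U).
Proof.
rewrite memv_ker; apply: (iffP eqP) => [Gw u uU|wU].
  have wb b : b \in vbasis U -> herm w b = 0.
    (* This product is the sum of the squares of the absolute values of [herm w b], so each of them
       vanishes. *)
    move=> bU; have : herm (gram_map U w) w = 0 by rewrite Gw herm0l.
    rewrite gram_mapE herm_suml.
    under eq_bigr do rewrite hermZl -[herm _ w]herm_conj.
    move=> /eqP; rewrite psumr_eq0 => [/allP/(_ b bU)|c _]; last exact: mul_conjC_ge0.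
    by rewrite mul_conjC_eq0 => /eqP.
  rewrite (coord_vbasis uU); apply: herm_sym0; rewrite herm_suml big1 // => i _.
  by rewrite hermZl herm_sym0 ?mulr0 // wb // mem_nth // size_tuple.
rewrite gram_mapE big_seq big1 // => b bU; rewrite wU ?scale0r //.
exact: vbasis_mem.
Qed.

Lemma perp_cap U : (U :&: perp U)%VS = 0%VS.
Proof.
apply: subv_anti; rewrite sub0v andbT; apply/subvP => u.
rewrite memv_cap memv0 => /andP[uU /perpP/(_ u uU)] /eqP.
by rewrite herm_eq0.
Qed.

(** The Gram operator maps V into U and is injective on U, so it maps U onto U. Some u in U has the
    same image as w, and w - u is in the kernel. *)
Lemma perp_add U : (U + perp U)%VS = fullv.
Proof.
apply/vspaceP => w; rewrite memvf.
have GU u : gram_map U u \in U.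
  by rewrite gram_mapE big_seq memv_suml // => b bU; rewrite memvZ // vbasis_mem.
have sGU : (gram_map U @: U <= U)%VS by apply/subvP => _ /memv_imgP[u _ ->].
have : gram_map U w \in (gram_map U @: U)%VS.
  suff -> : (gram_map U @: U)%VS = U by [].
  by apply/eqP; rewrite eqEdim sGU (limg_dim_eq (perp_cap U)) leqnn.
case/memv_imgP => u uU Gwu; rewrite -(subrK u w) addrC memv_add //.
by rewrite memv_ker linearB /= Gwu subrr.
Qed.

(** The generators are real symmetric, so T is closed under adjoints; this makes orthogonal
    complements of modules modules again. *)
Lemma inT_adjoint B : inT e x B ->
  exists2 B', inT e x B' & forall u w : V, herm (B *m u) w = herm u (B' *m w).
Proof.
elim=> {B} [|i iD||B1 B2 _ [C1 T1 E1] _ [C2 T2 E2]|a B _ [C1 T1 E1]|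
    B1 B2 _ [C1 T1 E1] _ [C2 T2 E2]].
- by exists Aj => [|u w]; [exact: inT_adj|exact: dist_adj].
- by exists (Ed i) => [|u w]; [exact: inT_dual|exact: dual_adj].
- by exists 1%:M => [|u w]; [exact: inT_one|rewrite !mul1mx].
- exists (C1 + C2) => [|u w]; first exact: inT_add.
  by rewrite !mulmxDl hermDl hermDr E1 E2.
- exists (a^* *: C1) => [|u w]; first exact: inT_scale.
  by rewrite -!scalemxAl hermZl hermZr conjCK E1.
- exists (C2 *m C1) => [|u w]; first exact: inT_mul.
  by rewrite -!mulmxA E1 E2.
Qed.

Lemma perp_Tmodule U : Tmod U -> Tmod (perp U).
Proof.
move=> mU B w TB /perpP wU; apply/perpP => u uU.
have [B' TB' ->] := inT_adjoint TB; apply: wU; exact: mU.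
Qed.

Lemma cap_Tmodule U W : Tmod U -> Tmod W -> Tmod (U :&: W)%VS.
Proof. by move=> mU mW B w TB; rewrite !memv_cap => /andP[? ?]; rewrite mU ?mW. Qed.

(** A nonzero submodule of minimal dimension is irreducible. *)
Lemma exists_irreducible W : Tmod W -> W != 0%VS ->
  exists U, Tirr U /\ (U <= W)%VS.
Proof.
move=> mW W0.
pose P m := `[< exists U, [/\ Tmod U, U != 0%VS, (U <= W)%VS & \dim U = m] >].
have exP : exists m, P m by exists (\dim W); apply/asboolP; exists W.
case: (ex_minnP exP) => m /asboolP[U [mU U0 UW <-]] minU.
exists U; split=> //; split=> // U' mU' U'U.
have [->|U'0] := eqVneq U' 0%VS; [by left|right].
apply/eqP; rewrite eqEdim U'U minU //; apply/asboolP; exists U'; split=> //.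
exact: subv_trans UW.
Qed.

Lemma sumv_seq_sup (s : seq {vspace V}) U : U \in s -> (U <= \sum_(W <- s) W)%VS.
Proof. by move=> Us; rewrite (big_rem U) //= addvSl. Qed.

Lemma exists_decomposition W : Tmod W -> exists s : seq {vspace V},
  [/\ forall U, U \in s -> Tirr U,
      forall i j, (i < j < size s)%N -> orth (nth 0%VS s i) (nth 0%VS s j) &
      (\sum_(U <- s) U)%VS = W].
Proof.
have [n] := ubnP (\dim W); elim: n W => // n IH W; rewrite ltnS => Wn mW.
have [->|W0] := eqVneq W 0%VS.
  by exists [::]; split=> //; rewrite ?big_nil // => i j; rewrite ltn0 andbF.
have [U [iU UW]] := exists_irreducible mW W0; have [mU U0 _] := iU.
pose W' := (W :&: perp U)%VS.
(* The modular law splits the irreducible U off W; the induction goes on with the smaller complement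
   [W']. *)
have WE : (U + W')%VS = W by rewrite /W' capvC vspace_modl // perp_add capfv.
have cap0 : (U :&: W')%VS = 0%VS by rewrite capvA (capvC U) -capvA perp_cap capv0.
have [||s [is_ os ss]] := IH W'.
- have := dimv_disjoint_sum cap0; rewrite WE.
  by move: U0 Wn; rewrite -dimv_eq0; move: (\dim W) (\dim U) (\dim W') => a b c; lia.
- exact: cap_Tmodule (perp_Tmodule mU).
exists (U :: s); split.
- by move=> U'; rewrite inE => /orP[/eqP->|/is_].
- move=> [|i] [|j] //= ij; last exact: os.
  have jP : nth 0%VS s j \in s by rewrite mem_nth.
  move=> u w uU wj; apply: herm_sym0.
  have : w \in W' by rewrite -ss (subvP (sumv_seq_sup jP)).
  by rewrite memv_cap => /andP[_ /perpP/(_ u uU)].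
- by rewrite big_cons ss.
Qed.

Lemma Tfull : Tmod fullv.
Proof. by move=> B w _ _; rewrite memvf. Qed.

(** The orthogonal projection onto W commutes with T. If some u in U is not orthogonal to W, the
    projection is nonzero on U, and Schur's lemma gives an isomorphism. *)
Lemma orthogonal_of_not_iso U W : Tirr U -> Tirr W -> ~ Tiso U W -> orth U W.
Proof.
move=> iU iW nUW u w uU wW; have [mW _ _] := iW; have [mU _ _] := iU.
apply: contra_notP nUW => /eqP uw.
pose pi := daddv_pi W (perp W); have capW := perp_cap W.
have capW' : (perp W :&: W)%VS = 0%VS by rewrite capvC.
have piE v : exists2 q, q \in perp W & v = pi v + q.
  exists (daddv_pi (perp W) W v); first exact: memv_pi.
  by rewrite daddv_pi_add // perp_add memvf.
have piW v : pi v \in W by apply: memv_pi.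
have pi0 v : v \in perp W -> pi v = 0.
  move=> vp; have := daddv_pi_add capW (w := v); rewrite perp_add memvf => /(_ isT).
  by rewrite (daddv_pi_id capW' vp) => /(canRL (addrK _)); rewrite subrr.
apply: (@Thom_iso _ _ _ _ U W pi u) => //.
  move=> B v TB _; have [q qp vE] := piE v; rewrite [in LHS]vE mulmxDr linearD /=.
  rewrite (pi0 (B *m q)) ?addr0; last exact: perp_Tmodule.
  by apply: daddv_pi_id => //; apply: mW.
apply: contraNneq uw => pu; have [q /perpP qp uE] := piE u.
by rewrite uE pu add0r qp.
Qed.

(** * The multiplicity as a dimension *)

Section Graph.
Hypothesis e_bip : bipartite e.
Hypothesis e_dreg : distance_regular e.
Hypothesis D_ge2 : (2 <= D)%N.

(** Two vertices have common neighbours only at distance 0 or 2. As c_2 is nonzero, this puts A_2 in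
    T, so isomorphisms preserve local eigenvalues. *)
Lemma dist1_sqr : Aj *m Aj =
  (inter_num e 0 1 1)%:R *: 1%:M + (inter_num e 2 1 1)%:R *: dist_mx R e 2.
Proof.
apply/matrixP => a b; rewrite !mxE.
transitivity ((inter_num e (dd (enum_val a) (enum_val b)) 1 1)%:R : C).
  rewrite (inter_numE e_dreg 1 1 (erefl _)) -sum1_card natr_sum [RHS]big_mkcond /=.
  rewrite -(sum_ev (fun w => if w \in _ then _ else _)); apply: eq_bigr => c _.
  rewrite !mxE !inE (gdist_sym e_sym e_conn (enum_val b)).
  by case: eqP => _; case: eqP => _ /=; rewrite ?mulr1 ?mulr0.
rewrite -(inj_eq enum_val_inj) -(gdist_eq0 e_conn).
case h: (dd (enum_val a) (enum_val b)) => [|[|[|n]]];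
  rewrite /= ?(mulr1, mulr0, addr0, add0r) //.
all: rewrite (inter_numE e_dreg _ _ h); apply/eqP; rewrite pnatr_eq0 cards_eq0.
all: apply/eqP/setP => w; rewrite !inE; apply/negbTE/negP => /andP[/eqP aw /eqP bw].
all: have := gdist_triangle e_conn w (enum_val a) (enum_val b).
all: have := gdist_parity e_conn e_bip (enum_val a) w (enum_val b).
all: by rewrite aw (gdist_sym e_sym e_conn w) bw h.
Qed.

Lemma inT_dist2 : inT e x (dist_mx R e 2).
Proof.
have c0 : (inter_num e 2 1 1)%:R != 0 :> C.
  by rewrite pnatr_eq0 -lt0n (inter_num_2_1_1_gt0 e_sym e_irr e_conn e_dreg).
have -> : dist_mx R e 2 = (inter_num e 2 1 1)%:R^-1 *:
    (Aj *m Aj + (- (inter_num e 0 1 1)%:R) *: 1%:M).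
  by rewrite dist1_sqr scaleNr addrAC subrr add0r scalerA mulVf // scale1r.
apply: inT_scale; apply: inT_add; first by apply: inT_mul; apply: inT_adj.
by apply: inT_scale; apply: inT_one.
Qed.

Lemma thin_endpoint2_transport eta U W : Tirr U -> Tiso U W ->
  thin_endpoint2 e x eta W -> thin_endpoint2 e x eta U.
Proof.
move=> iU UW [iW tW W2 [w [w2 w0 weta]]]; have [mU _ _] := iU.
have dimE i iD := Tiso_dim mU UW (i := i) iD.
have [f [fU kerf fT]] := UW; have [mW _ _] := iW.
split=> //; first by move=> i iD; rewrite dimE // tW.
  by rewrite (eq_endpoint dimE).
have [u uU wE] : exists2 u, u \in U & w = f (Ed 2 *m u).
  have /(dual_subP _ _ mW)[wW <-] := w2.
  move: wW; rewrite -fU => /memv_imgP[u uU ->]; exists u => //.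
  by rewrite fT //; apply: inT_dual.
have EuU : Ed 2 *m u \in U by apply: Tmodule_dual.
exists (Ed 2 *m u); split; first by apply/mximgP; exists u.
  by apply: contraNneq w0 => u0; rewrite wE u0 linear0.
have TE : inT e x (Ed 2 *m dist_mx R e 2 *m Ed 2).
  by apply: inT_mul; [apply: inT_mul; [exact: inT_dual|exact: inT_dist2]|exact: inT_dual].
(* The difference of the two sides lies in U and is killed by f, which is injective on U. *)
apply/eqP; rewrite -subr_eq0 -memv0 -kerf memv_cap memvB ?memvZ //=; last exact: mU.
by rewrite memv_ker linearB linearZ /= fT // -wE weta subrr.
Qed.

(** The images under E*_2 stay inside the mutually orthogonal summands, so their dimensions add
    up. *)
Lemma dim_dual_sum (t : pred {vspace V}) (s : seq {vspace V}) :
  (forall U, U \in s -> Tmod U) ->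
  (forall i j, (i < j < size s)%N -> orth (nth 0%VS s i) (nth 0%VS s j)) ->
  (forall U, U \in s -> t U -> \dim (mximg (Ed 2) U) = 1%N) ->
  \dim (mximg (Ed 2) (\sum_(U <- s | t U) U)) = count t s.
Proof.
elim: s => [|U s IH] ms os ts; first by rewrite big_nil /mximg limg0 dimv0.
have {}IH : \dim (mximg (Ed 2) (\sum_(U <- s | t U) U)) = count t s.
  apply: IH => [W Ws|i j ij|W Ws]; [apply: ms|exact: (os i.+1 j.+1)|apply: ts];
    by rewrite inE Ws orbT.
have msum : Tmod (\sum_(U <- s | t U) U)%VS.
  rewrite big_seq_cond; elim/big_ind: _ => [B w _|U1 U2 m1 m2 B w TB|W /andP[Ws _]].
  - by rewrite !memv0 => /eqP ->; rewrite mulmx0.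
  - by case/memv_addP=> u1 h1 [u2 h2 ->]; rewrite mulmxDr memv_add ?m1 ?m2.
  - by apply: ms; rewrite inE Ws orbT.
rewrite big_cons /=; case: ifP => tU; last by rewrite IH.
rewrite /mximg limgD -/(mximg _ _) -/(mximg _ _) dimv_disjoint_sum.
  by rewrite IH ts ?mem_head.
have Uperp : (\sum_(U <- s | t U) U <= perp U)%VS.
  rewrite big_seq_cond; elim/big_ind: _ => [|U1 U2 h1 h2|W /andP[Ws _]].
  - exact: sub0v.
  - by rewrite subv_add h1.
  - apply/subvP => w wW; apply/perpP => u uU; apply: herm_sym0.
    have := os 0%N (index W s).+1; rewrite /= ltnS index_mem Ws nth_index //.
    by move=> /(_ isT) h; apply: h.
apply: subv_anti; rewrite sub0v andbT -[X in (_ <= X)%VS](perp_cap U) capvS //.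
  by apply: mximg_sub => u uU; apply: Tmodule_dual => //; apply: ms; rewrite mem_head.
apply: subv_trans Uperp; apply: mximg_sub => u uU; exact: Tmodule_dual.
Qed.

Lemma thin_endpoint2_dim eta W : thin_endpoint2 e x eta W ->
  \dim (mximg (Ed 2) W) = 1%N.
Proof.
case=> _ tW /(endpoint2 D_ge2)[_ E2] _; apply/eqP; rewrite eqn_leq tW //.
by rewrite lt0n dimv_eq0.
Qed.

Lemma mu_dim eta : mu e x eta = \dim (mximg (Ed 2) (Hsub e x eta)).
Proof.
have HP := span_ofP (thin_endpoint2 e x eta); rewrite -/(Hsub e x eta) in HP.
rewrite /mu; case: asboolP => [[W0 tW0]|noW]; last first.
  have -> : Hsub e x eta = 0%VS.
    apply: subv_anti; rewrite sub0v andbT; apply/subvP => w /HP[s [sP]].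
    by case: s sP => [|W s] sP; [rewrite big_nil|case: noW; exists W; apply/sP/mem_head].
  by rewrite /mximg limg0 dimv0.
have := classical_sets.xgetPex 0%VS (ex_intro _ W0 tW0 : exists W, thin_endpoint2 e x eta W).
set W := classical_sets.xget _ _ => tW {W0 tW0}; rewrite /multiplicity.
have [s0 s0P] : exists s : seq {vspace V}, orthogonal_decomposition e x s.
  by have [s sP] := exists_decomposition Tfull; exists s.
have := classical_sets.xgetPex [::] (ex_intro _ s0 s0P : exists s, orthogonal_decomposition e x s).
set s := classical_sets.xget _ _ => - [is_ os ss] {s0 s0P}.
have irrW := tW; case: irrW => irrW _ _ _.
pose t U := `[< thin_endpoint2 e x eta U >].
(* Among the summands, being isomorphic to W is the same as being thin with endpoint 2 and local
   eigenvalue [eta]. *)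
have -> : count (fun U => `[< Tiso U W >]) s = count t s.
  apply: eq_in_count => U Us; apply/asboolP/asboolP => [UW|tU].
  exact: thin_endpoint2_transport (is_ _ Us) UW tW.
  exact: thin_endpoint2_iso tU tW.
have ms U : U \in s -> Tmod U by move=> Us; have [] := is_ _ Us.
rewrite -(dim_dual_sum ms os) => [|U _ /asboolP tU]; last exact: thin_endpoint2_dim tU.
congr (\dim (mximg _ _)); apply: subv_anti; apply/andP; split.
  apply/subvP => w wK; apply/HP; exists (filter t s); rewrite big_filter.
  by split=> // U; rewrite mem_filter => /andP[/asboolP].
apply/subvP => w /HP[s' [s'P]]; apply: subvP.
rewrite big_seq; elim/big_ind: _ => [|U1 U2 h1 h2|W' /s'P tW']; first exact: sub0v.
  by rewrite subv_add h1.
apply/subvP => v vW'.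
have : v \in (\sum_(U <- s) U)%VS by rewrite ss memvf.
(* Here k collects the components of v in the summands of the required type and [k'] those in the
   others; it remains to show [k'] = 0. *)
rewrite (bigID t) /= => /memv_addP[k kK [k' k'K vE]].
(* No summand of the other kind is isomorphic to U, so all of them are orthogonal to U. *)
have oK' U u : thin_endpoint2 e x eta U -> u \in U -> herm u k' = 0.
  move=> tU uU; move: k'K; rewrite big_seq_cond.
  suff sub : (\sum_(W1 <- s | (W1 \in s) && ~~ t W1) W1 <= perp U)%VS.
    by move=> /(subvP sub)/perpP/(_ u uU)/herm_sym0.
  elim/big_ind: _ => [|U1 U2 h1 h2|W1 /andP[W1s nt]]; first exact: sub0v.
    by rewrite subv_add h1.
  apply/subvP => w1 w1W; apply/perpP => u' u'U.
  apply: (orthogonal_of_not_iso (is_ _ W1s)) w1W u'U; first by case: tU.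
  move=> iso; move/asboolP: nt; apply.
  exact: thin_endpoint2_transport (is_ _ W1s) iso tU.
have kk' : herm k k' = 0.
  move: kK; rewrite -big_filter => kK.
  suff : k \in perp <[k']> by move/perpP; apply; apply: memv_line.
  apply: subvP kK; rewrite big_seq; elim/big_ind: _ => [|U1 U2 h1 h2|U].
  - exact: sub0v.
  - by rewrite subv_add h1.
  - rewrite mem_filter => /andP[/asboolP tU _]; apply/subvP => u uU.
    by apply/perpP => _ /vlineP[c ->]; rewrite hermZr (oK' _ _ tU uU) mulr0.
(* Both v and k are orthogonal to [k'], hence so is their difference, [k'] itself. *)
have : herm k' k' == 0.
  by have := oK' _ _ tW' vW'; rewrite vE hermDl kk' add0r => ->.
by rewrite herm_eq0 => /eqP k'0; rewrite vE k'0 addr0.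
Qed.

End Graph.
End Decomposition.

(** * Characteristic polynomials *)

Section CharPoly.

Lemma mup_prod_XsubC (F : fieldType) (s : seq F) a :
  mup a (\prod_(b <- s) ('X - b%:P)) = count_mem a s.
Proof.
elim: s => [|b s IH]; first by rewrite big_nil mupNroot // rootC oner_eq0.
rewrite big_cons mupM ?polyXsubC_eq0 ?IH //=.
  by rewrite -['X - b%:P]expr1 mup_XsubCX; case: (b == a).
by rewrite monic_neq0 // monic_prod_XsubC.
Qed.

(** Geometric multiplicity is at most algebraic multiplicity. In a basis [P] extending one of the
    eigenspace, X - a can be taken out of the first r rows of P (X - M), so its r-th power divides
    the determinant. *)
Lemma rank_eigenspace_le_count (F : fieldType) n (M : 'M[F]_n) (a : F) s :
  char_poly M = \prod_(b <- s) ('X - b%:P) ->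
  (\rank (eigenspace M a) <= count_mem a s)%N.
Proof.
move=> Ms; pose K := eigenspace M a; pose r := \rank K; pose P := row_ebase K.
have rn : (r <= n)%N by apply: rank_leq_col.
pose Q0 : 'M[F]_n := pid_mx r; pose Q : 'M[{poly F}]_n := pid_mx r; pose Pc := map_mx polyC P.
pose h : {poly F} := 'X - a%:P; have [M1 M1E] : exists M1, M1 = char_poly_mx M by eexists.
have QP : Q *m Pc *m M1 = h *: (Q *m Pc).
  have PM : Q0 *m P *m M = a *: (Q0 *m P).
    have -> : Q0 *m P = invmx (col_ebase K) *m K.
      rewrite -[X in _ = _ *m X](mulmx_ebase K) -!mulmxA.
      by rewrite mulKmx // col_ebase_unit.
    rewrite -mulmxA scalemxAr; congr (_ *m _).
    by apply/eigenspaceP; apply: submx_refl.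
  have -> : Q *m Pc = map_mx polyC (Q0 *m P) by rewrite map_mxM map_pid_mx.
  rewrite M1E /char_poly_mx mulmxBr -map_mxM PM map_mxZ scalerBl.
  by rewrite mul_mx_scalar.
have QQ : Q *m Q = Q by rewrite pid_mx_id.
have fac : Pc *m M1 = (h *: Q + copid_mx r) *m (Q *m Pc + copid_mx r *m Pc *m M1).
  rewrite mulmxDl !mulmxDr -!scalemxAl !mulmxA QQ mul_pid_mx_copid //.
  rewrite mul_copid_mx_pid // copid_mx_id // !mul0mx scaler0 addr0 add0r -QP.
  by rewrite -!mulmxA -mulmxDl addrC subrK mul1mx.
have detD : \det (h *: Q + copid_mx r) = h ^+ r.
  have -> : h *: Q + copid_mx r = diag_mx (\row_(i < n) if (i < r)%N then h else 1).
    apply/matrixP => i j; rewrite !mxE; have [<-|ij] := eqVneq i j.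
      rewrite eqxx /=; case: ifP => _ /=; first by rewrite mulr1 subrr addr0.
      by rewrite mulr0 add0r subr0.
    by rewrite (negPf (_ : nat_of_ord i != j)) //= mulr0 subr0 addr0.
  rewrite det_diag (eq_bigr (fun i : 'I_n => if (i < r)%N then h else 1)); last first.
    by move=> i _; rewrite mxE.
  rewrite -big_mkcond prodr_const; congr (_ ^+ _).
  by rewrite -sum1_card -(big_ord_widen n (fun=> 1%N) rn) sum1_card card_ord.
have : h ^+ r %| \det Pc * char_poly M.
  by rewrite /char_poly -M1E -det_mulmx fac det_mulmx detD dvdp_mulIl.
rewrite det_map_mx mul_polyC dvdpZr; last first.
  by rewrite -unitfE -unitmxE row_ebase_unit.
by rewrite -mup_geq -?mup_prod_XsubC -?Ms // monic_neq0 // char_poly_monic.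
Qed.

(** Over the complex numbers the polynomial splits. For an eigenvector v with eigenvalue c the
    scalar v S v^* is real and equals c times a nonzero real number, so c is real. *)
Lemma symmetric_char_poly_split (R : realType) n (S : 'M[R]_n) : S^T = S ->
  exists s : seq R, char_poly S = \prod_(a <- s) ('X - a%:P).
Proof.
move=> St; pose f := real_complex R; pose CS := map_mx f S.
have [z zE] := closed_field_poly_normal (char_poly CS).
rewrite (monicP (char_poly_monic CS)) scale1r in zE.
exists [seq complex.Re c | c <- z]; apply: (map_poly_inj f).
rewrite map_char_poly zE rmorph_prod big_map; apply: eq_big_seq => c cz /=.
rewrite rmorphB /= map_polyX map_polyC /= RRe_real // CrealE.
have : eigenvalue CS c by rewrite eigenvalue_root_char zE root_prod_XsubC.
case/eigenvalueP => v vc v0.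
pose w := (map_mx Num.conj v)^T.
have vw0 : (v *m w) 0 0 != 0.
  apply: contraNneq v0; rewrite mxE.
  under eq_bigr do rewrite !mxE.
  move=> /eqP; rewrite psumr_eq0 => [/allP h|i _]; last exact: mul_conjC_ge0.
  apply/eqP/rowP => i; rewrite [RHS]mxE; apply/eqP; rewrite -mul_conjC_eq0.
  exact: h (mem_index_enum i).
have conj_scalar (M : 'M[R[i]]_1) : (map_mx Num.conj M)^T 0 0 = (M 0 0)^*.
  by rewrite !mxE.
have CSh : map_mx Num.conj CS = CS.
  by apply/matrixP => i j; rewrite !mxE; apply/eqP; rewrite -CrealE complex_real.
have wE : (map_mx Num.conj w)^T = v by apply/matrixP => i j; rewrite !mxE conjCK.
have CSt : CS^T = CS by apply/matrixP => i j; rewrite !mxE -[in LHS]St mxE.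
have := conj_scalar (v *m CS *m w).
rewrite !map_mxM /= !trmx_mul wE CSh CSt -/w mulmxA vc -!scalemxAl.
have := conj_scalar (v *m w); rewrite map_mxM /= trmx_mul wE -/w => vwr.
have -> : (c *: (v *m w)) 0 0 = c * (v *m w) 0 0 by rewrite mxE.
rewrite rmorphM /= -vwr => h.
by apply/eqP; apply: (mulIf vw0); rewrite h.
Qed.

End CharPoly.

(** * The local graph *)

Section LocalGraph.
Variables (X : finType) (e : rel X) (x : X).
Hypothesis e_sym : symmetric e.
Hypothesis e_irr : irreflexive e.
Hypothesis e_conn : forall y z : X, connect e y z.
Hypothesis e_bip : bipartite e.
Hypothesis e_dreg : distance_regular e.
Hypothesis D_ge3 : (3 <= diameter e)%N.

Local Notation dd := (gdist e).
Local Notation X2 := (sphere e 2 x).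
Local Notation X1 := (sphere e 1 x).
Local Notation k := (valency e).
Local Notation c2 := (inter_num e 2 1 1).
Local Notation c3 := (inter_num e 3 1 2).
Local Notation b3 := (inter_b e 3).
Local Notation p222 := (inter_num e 2 2 2).

Let dsym := gdist_sym e_sym e_conn.
Let dadj y w z : dd y w = 1%N -> dd z y = (dd z w).+1 \/ dd z w = (dd z y).+1.
Proof. by move/eqP; rewrite gdist_eq1 //; apply: gdist_adj. Qed.

Lemma valency_b3_c3 : k = (b3 + c3)%N.
Proof.
have [y [z yz]] : exists y z, dd y z = 3%N by apply: gdist_attained.
rewrite (valencyE e_conn e_dreg y) /inter_b !(inter_numE e_dreg _ _ yz).
rewrite -cardsUI (_ : _ :&: _ :&: _ = finset.set0); last first.
  by apply/setP => w; rewrite !inE; case: (dd z w =P 4%N) => [->|]; rewrite ?andbF.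
rewrite cards0 addn0; apply: eq_card => w; rewrite !inE -andb_orr.
case: (dd y w =P 1%N) => //= yw; have := dadj z yw.
by rewrite (dsym z y) yz => -[[<-]|->].
Qed.

Lemma valency_gt_c2 : (c2 < k)%N.
Proof.
have [y [z yz]] : exists y z, dd y z = 3%N by apply: gdist_attained.
have [w yw wz] := gdist_step e_irr e_conn yz.
rewrite (valencyE e_conn e_dreg w) (inter_numE e_dreg _ _ wz).
apply: proper_card; apply/properP; split; first exact: subsetIl.
exists y; rewrite !inE ?(dsym w y) ?gdist_eq1 // yw //=.
by rewrite -(gdist_eq1 e_irr e_conn) (dsym z y) yz.
Qed.

Lemma valency_endpoint w : dd x w = 1%N ->
  k = #|[set z | (dd x z == 2) && (dd z w == 1)]%N|.+1.
Proof.
move=> xw; rewrite (valencyE e_conn e_dreg w) (cardsD1 x) inE dsym xw eqxx add1n.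
congr _.+1; apply: eq_card => z; rewrite !inE (dsym w z).
case: (dd z w =P 1%N) => zw; rewrite ?andbF // !andbT -(gdist_eq0 e_conn) (dsym z x).
by case: (dadj x zw); rewrite xw; [move=> -> //|case=> <-].
Qed.

Lemma card_common2 w w' : dd x w = 1%N -> dd x w' = 1%N -> w != w' ->
  c2 = #|[set z | [&& dd x z == 2, dd z w == 1 & dd z w' == 1]]%N|.+1.
Proof.
move=> xw xw' ww'.
have dww' : dd w w' = 2%N.
  have := dadj w xw'; rewrite (dsym w x) xw => -[[/esym/eqP]|-> //].
  by rewrite gdist_eq0 // (negPf ww').
rewrite (inter_numE e_dreg _ _ dww') (cardsD1 x) !inE !(dsym _ x) xw xw' eqxx add1n.
congr _.+1; apply: eq_card => z; rewrite !inE (dsym w z) (dsym w' z).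
case: (dd z w =P 1%N) => zw; rewrite ?andbF //= andbC.
rewrite -(gdist_eq0 e_conn) (dsym z x) [RHS]andbC; congr (_ && _).
by case: (dadj x zw); rewrite xw; [move=> -> //|case=> <-].
Qed.

(** If y is adjacent to w, the neighbours of w other than x and y qualify, and k = b_3 + c_3.
    Otherwise y and w are at distance 3, and of the c_3 neighbours of w at distance 2 from y only x
    is excluded. Adding 2 or 1 on the left avoids truncated subtraction. *)
Lemma card_local y w : dd x y = 2%N -> dd x w = 1%N ->
  (#|[set z | [&& dd x z == 2, dd y z == 2 & dd z w == 1]]%N| +
     (if dd y w == 1 then 2 else 1) = if dd y w == 1 then b3 + c3 else c3)%N.
Proof.
move=> xy xw; case: eqP => yw.
  rewrite -valency_b3_c3 (valencyE e_conn e_dreg w) (cardsD1 x (sphere e 1 w)) inE dsym xw eqxx add1n.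
  rewrite (cardsD1 y (_ :\ _)) !inE (dsym w y) yw -(gdist_eq0 e_conn) (dsym y x) xy eqxx add1n addn2.
  congr _.+2; apply: eq_card => z; rewrite !inE (dsym w z).
  case: (dd z w =P 1%N) => zw; rewrite ?andbF // !andbT.
  rewrite -!(gdist_eq0 e_conn) (dsym z x) (dsym z y) andbC.
  have := dadj x zw; have := dadj y zw; rewrite xw yw.
  move: (dd x z) (dd y z) => n m; lia.
have {}yw : dd w y = 3%N.
  by have := dadj y xw; rewrite (dsym y x) xy (dsym w y) => -[[/esym]|->].
rewrite (inter_numE e_dreg _ _ yw) (cardsD1 x (_ :&: _)) !inE !(dsym _ x) xw xy !eqxx add1n addn1.
congr _.+1; apply: eq_card => z; rewrite !inE (dsym w z).
case: (dd z w =P 1%N) => zw; rewrite ?andbF //= andbT -(gdist_eq0 e_conn) (dsym z x).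
congr (_ && _).
by case: (dadj x zw); rewrite xw; [move=> -> //|case=> <-].
Qed.

(** * Eigenvectors of the local graph from the incidence matrix *)

Variable R : realType.
Local Notation C := R[i].
Local Notation CA := (map_mx (real_complex R) (adj22 R e x)).

Definition incidence : 'M[C]_(#|X2|, #|X1|) :=
  \matrix_(a, b) (dd (enum_val a) (enum_val b) == 1%N)%:R.

Local Notation N := incidence.

Lemma adj22E a b : CA a b = (dd (enum_val a) (enum_val b) == 2%N)%:R.
Proof. by rewrite !mxE rmorph_nat. Qed.

Lemma adj22_sym : (adj22 R e x)^T = adj22 R e x.
Proof. by apply/matrixP => a b; rewrite !mxE dsym. Qed.

Lemma sum_bool_enum (S : {set X}) (P Q : pred X) :
  \sum_(a < #|S|) (P (enum_val a))%:R * (Q (enum_val a))%:R =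
    #|[set z | [&& z \in S, P z & Q z]]|%:R :> C.
Proof.
rewrite -(big_enum_val (fun z => (P z)%:R * (Q z)%:R)) -sum1_card natr_sum.
rewrite big_mkcond [RHS]big_mkcond; apply: eq_bigr => z _ /=; rewrite !inE.
by case: (z \in S); case: (P z); case: (Q z); rewrite /= ?mulr1 ?mulr0 ?mul0r.
Qed.

Lemma adj22_incidence : CA *m N = (b3%:R - 1) *: N + (c3%:R - 1) *: const_mx 1.
Proof.
apply/matrixP => a b; rewrite [LHS]mxE.
have := enum_valP a; rewrite inE => /eqP xy.
have := enum_valP b; rewrite inE => /eqP xw.
move: (card_local xy xw); set n := #|_| => h.
transitivity (n%:R : C).
  under eq_bigr do rewrite adj22E mxE.
  rewrite (sum_bool_enum X2 (fun z => dd (enum_val a) z == 2%N)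
    (fun z => dd z (enum_val b) == 1%N)).
  by congr (_ %:R); apply: eq_card => z; rewrite !inE.
rewrite !mxE; move/(congr1 (fun n => n%:R : C)): h; rewrite natrD.
move/(canRL (addrK _)) => ->.
case: eqP => _; first by rewrite natrD !mulr1 mulr2n opprD addrACA.
by rewrite mulr0 add0r mulr1.
Qed.

(** At level 2 a vertex of level 1 has k - 1 neighbours, and two distinct such vertices share c_2 -
    1 of them: x accounts for the missing one. *)
Lemma incidence_gram : N^T *m N = (k%:R - c2%:R)%:M + (c2%:R - 1) *: const_mx 1.
Proof.
apply/matrixP => b b'; rewrite [LHS]mxE.
have := enum_valP b; rewrite inE => /eqP xw.
have := enum_valP b'; rewrite inE => /eqP xw'.
under eq_bigr do rewrite !mxE.
rewrite (sum_bool_enum X2 (fun z => dd z (enum_val b) == 1%N)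
    (fun z => dd z (enum_val b') == 1%N)) !mxE mulr1.
have [<-|bb'] := eqVneq b b'.
  rewrite mulr1n addrA subrK (valency_endpoint xw) -natr1 addrK.
  by congr (_ %:R); apply: eq_card => z; rewrite !inE andbb.
rewrite mulr0n add0r (card_common2 xw xw' _) ?(inj_eq enum_val_inj) //.
rewrite -natr1 addrK.
by congr (_ %:R); apply: eq_card => z; rewrite !inE.
Qed.

Lemma incidence1 : N *m const_mx 1 = c2%:R *: const_mx 1 :> 'cV_#|X2|.
Proof.
apply/matrixP => a j; rewrite !mxE mulr1.
have := enum_valP a; rewrite inE => /eqP xy.
under eq_bigr do rewrite !mxE.
transitivity (#|[set z | [&& z \in X1, dd (enum_val a) z == 1%N & true]]|%:R : C).
  by rewrite -(sum_bool_enum X1 (fun z => dd (enum_val a) z == 1%N) xpredT).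
congr (_ %:R); rewrite (inter_numE e_dreg 1 1 xy); apply: eq_card => z.
by rewrite !inE andbT.
Qed.

Lemma adj22_1 : CA *m const_mx 1 = p222%:R *: const_mx 1 :> 'cV_#|X2|.
Proof.
apply/matrixP => a j; rewrite [LHS]mxE !mxE mulr1.
have := enum_valP a; rewrite inE => /eqP xy.
under eq_bigr do rewrite adj22E [const_mx _ _ _]mxE.
transitivity (#|[set z | [&& z \in X2, dd (enum_val a) z == 2%N & true]]|%:R : C).
  by rewrite -(sum_bool_enum X2 (fun z => dd (enum_val a) z == 2%N) xpredT).
congr (_ %:R); rewrite (inter_numE e_dreg 2 2 xy); apply: eq_card => z.
by rewrite !inE andbT.
Qed.

Lemma card_X1 : #|X1| = k.
Proof. by rewrite (valencyE e_conn e_dreg x). Qed.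

Lemma ones_mul (v : 'rV[C]_#|X1|) :
  v *m const_mx 1 = (v *m (const_mx 1 : 'cV_#|X1|)) 0 0 *: (const_mx 1 : 'rV_#|X1|).
Proof.
apply/rowP => i; rewrite !mxE mulr1.
by apply: eq_bigr => j _; rewrite !mxE.
Qed.

Lemma ones_row_col : ((const_mx 1 : 'rV[C]_#|X1|) *m (const_mx 1 : 'cV_#|X1|)) 0 0 = k%:R.
Proof.
rewrite mxE; under eq_bigr do rewrite !mxE mulr1.
by rewrite sumr_const card_ord card_X1.
Qed.

Lemma valency_gt0 : (0 < k)%N. Proof. exact: leq_ltn_trans valency_gt_c2. Qed.

(** The Gram matrix has the nonzero eigenvalues k - c_2 + (c_2 - 1) k on the all-ones vector and k -
    c_2 on vectors of sum 0. The first forces the sum s of c to vanish, the second c itself. *)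
Lemma incidence_inj (c : 'rV_#|X1|) : c *m N^T *m N = 0 -> c = 0.
Proof.
move=> cN; pose s := (c *m (const_mx 1 : 'cV_#|X1|)) 0 0.
have kc : k%:R - c2%:R != 0 :> C.
  by rewrite subr_eq0 eqr_nat eq_sym neq_ltn valency_gt_c2.
have cE : (k%:R - c2%:R) *: c + ((c2%:R - 1) * s) *: const_mx 1 = 0.
  by rewrite -cN -mulmxA incidence_gram mulmxDr mul_mx_scalar -scalemxAr ones_mul scalerA.
have s0 : s = 0.
  have : ((k%:R - c2%:R) + (c2%:R - 1) * k%:R) * s = 0.
    move/(congr1 (fun v => (v *m (const_mx 1 : 'cV_#|X1|)) 0 0)): cE.
    rewrite mul0mx mulmxDl -!scalemxAl [X in X = _]mxE => h.
    move: h; rewrite [X in X + _]mxE [X in _ + X]mxE ones_row_col [RHS]mxE -/s => <-.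
    by rewrite mulrDl mulrAC.
  move/eqP; rewrite mulf_eq0 => /orP[|/eqP //].
  rewrite gt_eqF // ltr_wpDr ?subr_gt0 ?ltr_nat ?valency_gt_c2 //.
  rewrite mulr_ge0 ?ler0n // subr_ge0 ler1n.
  exact: (inter_num_2_1_1_gt0 e_sym e_irr e_conn e_dreg (ltnW D_ge3)).
move: cE; rewrite s0 mulr0 scale0r addr0 => /eqP.
by rewrite scaler_eq0 (negPf kc) => /eqP.
Qed.

Lemma incidence_free : row_free N^T.
Proof. by apply: inj_row_free => v vN; apply: incidence_inj; rewrite vN mul0mx. Qed.

Local Notation base_spectrum := ((p222%:R : R) :: nseq k.-1 (b3%:R - 1)).

(* The rows of N^T span E*_2 V_0 + E*_2 Y; the rows of Q are orthogonal to
   them, and N^T is injective, so both contribute to the eigenspace. *)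
Lemma eigenspace_bound (a : R) m (Q : 'M[C]_(m, #|X2|)) :
  row_free Q -> Q *m CA = real_complex R a *: Q -> Q *m N = 0 ->
  (m + count_mem a base_spectrum <= \rank (eigenspace CA (real_complex R a)))%N.
Proof.
move=> Qf Qa QN; pose col1 : 'cV[C]_#|X1| := const_mx 1.
(* [F1] carries the eigenvalue p^2_22 and [F2], the k - 1 dimensional space of vectors of sum 0,
   carries b_3 - 1. Each is replaced by 0 when its eigenvalue is not a; both remain when the two
   eigenvalues coincide. *)
pose F1 : 'rV[C]_#|X1| := if p222%:R == a then const_mx 1 else 0.
pose F2 : 'M[C]_#|X1| := if b3%:R - 1 == a then kermx col1 else 0.
have k0 : k%:R != 0 :> C by rewrite pnatr_eq0 -lt0n valency_gt0.
have CAt : CA^T = CA by apply/matrixP => i j; rewrite !mxE dsym.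
have F12 : (F1 :&: F2 = 0)%MS.
  apply/eqP; rewrite -submx0; apply/rV_subP => u; rewrite sub_capmx => /andP[].
  rewrite /F1 /F2; case: ifP => _; last by move/submx0null => ->; rewrite !sub0mx.
  case: ifP => _ uF1; last by move/submx0null => ->; rewrite !sub0mx.
  case/sub_rVP: uF1 => c -> /sub_kermxP.
  rewrite -scalemxAl /col1 => /(congr1 (fun M : 'M_1 => M 0 0)) /=.
  rewrite [LHS]mxE ones_row_col [RHS]mxE => /eqP; rewrite mulf_eq0 (negPf k0) orbF.
  by move/eqP->; rewrite scale0r sub0mx.
have rank_col1 : \rank col1 = 1%N.
  rewrite -mxrank_tr trmx_const rank_rV; case: eqP => // /rowP h.
  have i : 'I_#|X1| by rewrite card_X1; exact: Ordinal valency_gt0.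
  by move/eqP: (h i); rewrite !mxE oner_eq0.
have rank_row1 : \rank (const_mx 1 : 'rV[C]_#|X1|) = 1%N.
  by rewrite -mxrank_tr trmx_const.
have cnt : count_mem a base_spectrum = \rank (F1 + F2)%MS.
  rewrite mxrank_disjoint_sum // /= count_nseq; congr (_ + _)%N.
    by rewrite /F1; case: ifP => _; rewrite ?rank_row1 ?mxrank0.
  rewrite /F2 /=; case: ifP => _; rewrite ?mxrank0 ?mul0n // mul1n.
  by rewrite mxrank_ker rank_col1 card_X1 subn1.
pose G := ((F1 + F2)%MS *m N^T).
have rG : \rank G = count_mem a base_spectrum.
  by rewrite cnt mxrankMfree // incidence_free.
have subG : (G <= eigenspace CA (real_complex R a))%MS.
  rewrite /G addsmxMr addsmx_sub; apply/andP; split.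
    rewrite /F1; case: eqP => [<-|_]; last by rewrite mul0mx sub0mx.
    apply/eigenspaceP; apply: trmx_inj; rewrite !linearZ /= !trmx_mul CAt trmxK trmx_const.
    by rewrite incidence1 -scalemxAr adj22_1 !scalerA rmorph_nat mulrC.
  rewrite /F2; case: eqP => [<-|_]; last by rewrite mul0mx sub0mx.
  move: (kermx col1) (mulmx_ker col1) => K Kcol.
  apply/eigenspaceP; apply: trmx_inj; rewrite !linearZ /= !trmx_mul CAt trmxK mulmxA.
  rewrite adj22_incidence mulmxDl -!scalemxAl rmorphB rmorph1 rmorph_nat.
  suff -> : (const_mx 1 : 'M[C]_(#|X2|, #|X1|)) *m K^T = 0.
    by rewrite scaler0 addr0.
  apply/trmx_inj; rewrite trmx_mul trmxK trmx0 trmx_const; apply/matrixP => i j.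
  have /matrixP/(_ i 0) := Kcol; rewrite !mxE => h; rewrite -[RHS]h.
  by apply: eq_bigr => l _; rewrite !mxE.
(* A common vector g N^T is annihilated by N, so [incidence_inj] gives that it is zero. *)
have QG : (Q :&: G = 0)%MS.
  apply/eqP; rewrite -submx0; apply/rV_subP => u; rewrite sub_capmx => /andP[].
  case/submxP => q -> /submxP[g qE].
  have : q *m Q *m N = 0 by rewrite -mulmxA QN mulmx0.
  by rewrite qE /G mulmxA => /incidence_inj ->; rewrite mul0mx sub0mx.
rewrite -rG -(eqP Qf) -mxrank_disjoint_sum //; apply: mxrankS.
by rewrite addsmx_sub subG andbT; apply/eigenspaceP.
Qed.

End LocalGraph.

(** * Comparison of multiplicities *)

Section Multiplicity.
Variables (R : realType) (X : finType) (e : rel X) (x : X).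
Hypothesis e_sym : symmetric e.
Hypothesis e_irr : irreflexive e.
Hypothesis e_conn : forall y z : X, connect e y z.
Hypothesis e_bip : bipartite e.
Hypothesis e_dreg : distance_regular e.
Hypothesis D_ge3 : (3 <= diameter e)%N.

Local Notation C := R[i].
Local Notation V := 'cV[C]_#|X|.
Local Notation dd := (gdist e).
Local Notation Aj := (dist_mx R e 1).
Local Notation Ed i := (dual_idem R e x i).
Local Notation X2 := (sphere e 2 x).
Local Notation k := (valency e).
Local Notation CA := (map_mx (real_complex R) (adj22 R e x)).
Local Notation base_spectrum :=
  (((inter_num e 2 2 2)%:R : R) :: nseq k.-1 ((inter_b e 3)%:R - 1)).

Lemma local_vectorD eta (v w : V) : local_vector e x eta v ->
  local_vector e x eta w -> local_vector e x eta (v + w).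
Proof.
move=> [v2 v1 ve] [w2 w1 we]; split; rewrite ?mulmxDr ?v2 ?w2 ?v1 ?w1 ?addr0 //.
by rewrite ve we scalerDr.
Qed.

Lemma local_vectorZ eta c (v : V) : local_vector e x eta v ->
  local_vector e x eta (c *: v).
Proof.
move=> [v2 v1 ve]; split; rewrite -?scalemxAr ?v2 ?v1 ?scaler0 //.
by rewrite ve !scalerA mulrC.
Qed.

Lemma local_vector0 eta : local_vector e x eta (0 : V).
Proof. by split; rewrite ?mulmx0 ?scaler0. Qed.

(** Each E*_2 W is a line spanned by a local vector, and local vectors form a subspace. *)
Lemma Hsub_local_vector eta w : w \in mximg (Ed 2) (Hsub e x eta) ->
  local_vector e x (eta%:C)%C w.
Proof.
case/mximgP => h hH ->; have /(span_ofP (thin_endpoint2 e x eta)) [s [sP]] := hH.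
elim: s sP h {hH} => [|W s IH] sP h.
  by rewrite big_nil memv0 => /eqP ->; rewrite mulmx0; apply: local_vector0.
rewrite big_cons => /memv_addP[h1 h1W [h2 h2s ->]]; rewrite mulmxDr.
apply: local_vectorD; last by apply: IH h2s => W' W's; apply: sP; rewrite inE W's orbT.
have tW := sP _ (mem_head _ _); have D_ge2 : (2 <= diameter e)%N by apply: ltnW.
have [v [vW v0 lv]] := thin_endpoint2_vector D_ge2 tW.
have [v2 _ _] := lv; have d1 := thin_endpoint2_dim D_ge2 tW.
have [||||b ->] := @vlineW _ _ (mximg (Ed 2) W) v (Ed 2 *m h1).
- by rewrite d1.
- by apply/mximgP; exists v.
- by apply/mximgP; exists h1.
- by [].
exact: local_vectorZ.
Qed.

Definition restrict2 (w : V) : 'rV[C]_#|X2| :=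
  \row_a w (enum_rank (enum_val a)) 0.

Lemma sum_level2 (w : V) (F : X -> C) : Ed 2 *m w = w ->
  \sum_(a < #|X2|) restrict2 w 0 a * F (enum_val a) =
  \sum_(c < #|X|) F (enum_val c) * w c 0.
Proof.
move=> w2; under eq_bigr do rewrite mxE.
rewrite -(big_enum_val (fun y => w (enum_rank y) 0 * F y)) /= big_mkcond /=.
transitivity (\sum_y F y * w (enum_rank y) 0).
  apply: eq_bigr => y _; rewrite inE mulrC -w2 dual_mulE enum_rankK.
  by case: eqP => //; rewrite mulr0.
rewrite -(sum_ev (fun y => F y * w (enum_rank y) 0)).
by apply: eq_bigr => c _; rewrite enum_valK.
Qed.

Lemma restrict2_eigen eta (w : V) : local_vector e x eta w ->
  restrict2 w *m CA = eta *: restrict2 w.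
Proof.
case=> w2 _ we; apply/rowP => b.
pose F y : C := (dd (enum_val b) y == 2%N)%:R.
transitivity (\sum_(a < #|X2|) restrict2 w 0 a * F (enum_val a)).
  rewrite mxE; apply: eq_bigr => a _; congr (_ * _).
  by rewrite adj22E (gdist_sym e_sym e_conn).
rewrite (sum_level2 F w2); move: we; rewrite -!mulmxA w2.
move/colP/(_ (enum_rank (enum_val b))); rewrite dual_mulE dist_mulE enum_rankK.
have := enum_valP b; rewrite inE => -> wE.
by apply: etrans wE _; rewrite !mxE.
Qed.

Lemma restrict2_incidence eta (w : V) : local_vector e x eta w ->
  restrict2 w *m incidence e x R = 0.
Proof.
case=> w2 w1 _; apply/rowP => b.
pose F y : C := (dd (enum_val b) y == 1%N)%:R.
transitivity (\sum_(a < #|X2|) restrict2 w 0 a * F (enum_val a)).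
  rewrite mxE; apply: eq_bigr => a _; congr (_ * _).
  by rewrite mxE (gdist_sym e_sym e_conn).
rewrite (sum_level2 F w2).
move/colP/(_ (enum_rank (enum_val b))): w1; rewrite dual_mulE dist_mulE enum_rankK.
have := enum_valP b; rewrite inE => -> wE.
by apply: etrans wE _; rewrite !mxE.
Qed.

Lemma restrict2_sum (I : finType) (c : I -> C) (F : I -> V) :
  restrict2 (\sum_i c i *: F i) = \sum_i c i *: restrict2 (F i).
Proof.
apply/rowP => a; rewrite mxE !summxE; apply: eq_bigr => i _.
by rewrite !mxE.
Qed.

Lemma restrict2_inj (w : V) : Ed 2 *m w = w -> restrict2 w = 0 -> w = 0.
Proof.
move=> w2 rw; apply/colP => c; rewrite [RHS]mxE -w2 dual_mulE.
case: eqP => // lc; have cX2 : enum_val c \in X2 by rewrite inE lc.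
move/rowP/(_ (enum_rank_in cX2 (enum_val c))): rw.
by rewrite !mxE enum_rankK_in // enum_valK.
Qed.

Lemma rank_local_eigenspace_le_count (s : seq R) a :
  char_poly (adj22 R e x) = \prod_(b <- s) ('X - b%:P) ->
  (\rank (eigenspace CA (real_complex R a)) <= count_mem a s)%N.
Proof.
move=> sE.
have CsE : char_poly CA = \prod_(b <- map (real_complex R) s) ('X - b%:P).
  rewrite -map_char_poly sE rmorph_prod big_map; apply: eq_bigr => b _.
  by rewrite rmorphB /= map_polyX map_polyC.
rewrite (leq_trans (rank_eigenspace_le_count (real_complex R a) CsE)) //.
rewrite count_map (eq_count (_ : _ =1 pred1 a)) // => b.
exact: (inj_eq (@complexI _)).
Qed.

(** This ensures that [mult] reads off a genuine spectrum. The bound for an empty [Q] shows that the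
    prescribed k eigenvalues occur in the spectrum with multiplicity, so they can be moved to the
    front. *)
Lemma local_spectrum_exists : exists s : seq R, local_spectrum e x s.
Proof.
have [s sE] := symmetric_char_poly_split (adj22_sym x e_sym e_conn R).
have cnt a : (count_mem a base_spectrum <= count_mem a s)%N.
  apply: leq_trans (rank_local_eigenspace_le_count a sE); rewrite -[leqLHS]add0n.
  apply: (eigenspace_bound e_sym e_irr e_conn e_bip e_dreg D_ge3 (Q := 0 : 'M_(0, _))).
  - by rewrite /row_free mxrank0.
  - by rewrite mul0mx scaler0.
  - by rewrite mul0mx.
have /count_subseqP[t /perm_to_subseq[r sr] tb] := cnt.
exists (base_spectrum ++ r); split.
  rewrite sE; apply: perm_big; apply: (perm_trans sr).
  by rewrite perm_cat2r perm_sym.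
rewrite take_size_cat //= size_nseq prednK //.
exact: (valency_gt0 e_sym e_irr e_conn e_dreg D_ge3).
Qed.

Lemma dim_Hsub_le_mult eta :
  (\dim (mximg (Ed 2) (Hsub e x eta)) <= mult e x eta)%N.
Proof.
rewrite /mult; have [s0 s0P] := local_spectrum_exists.
have := classical_sets.xgetPex [::] (ex_intro _ s0 s0P : exists s : seq R, local_spectrum e x s).
set s := classical_sets.xget _ _ => - [sE tE] {s0 s0P}.
pose W := mximg (Ed 2) (Hsub e x eta); pose B := vbasis W.
(* The rows are a basis of E*_2 H_eta, read as functions on the sphere of radius 2. *)
pose Q : 'M[C]_(\dim W, #|X2|) := \matrix_(i < \dim W) restrict2 B`_i.
have BW (i : 'I_(\dim W)) : B`_i \in W by rewrite vbasis_mem // mem_nth // size_tuple.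
have lB i : local_vector e x (eta%:C)%C B`_(i : 'I_(\dim W)).
  exact: Hsub_local_vector (BW i).
have Qf : row_free Q.
  apply: inj_row_free => c cQ; apply/rowP => i; rewrite [RHS]mxE.
  have /freeP/(_ (fun i => c 0 i)) := basis_free (vbasisP W); apply => {i}.
  apply: restrict2_inj.
    rewrite mulmx_sumr; apply: eq_bigr => i _; rewrite -scalemxAr.
    by have [-> _ _] := lB i.
  rewrite restrict2_sum; apply: etrans cQ; rewrite mulmx_sum_row.
  by apply: eq_bigr => i _; rewrite rowK.
have := rank_local_eigenspace_le_count eta sE.
(* The first k entries account exactly for the prescribed eigenvalues; cancelling them leaves the
   count over the remaining entries. *)
rewrite -[s in count_mem _ s](cat_take_drop k) count_cat tE => cnt.
rewrite -(leq_add2l (count_mem eta base_spectrum)) addnC; apply: leq_trans cnt.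
apply: (eigenspace_bound e_sym e_irr e_conn e_bip e_dreg D_ge3 Qf).
  by apply/row_matrixP => i; rewrite row_mul linearZ /= rowK (restrict2_eigen (lB i)).
by apply/row_matrixP => i; rewrite row_mul rowK (restrict2_incidence (lB i)) row0.
Qed.

End Multiplicity.

Theorem theorem17p5 (R : realType) (X : finType) (e : rel X)
  (e_sym : symmetric e) (e_irr : irreflexive e)
  (e_conn : forall y z : X, connect e y z)
  (e_bip : bipartite e) (e_dreg : distance_regular e)
  (D_ge4 : (4 <= diameter e)%N) (k_ge3 : (3 <= valency e)%N)
  (x : X) (eta : R) :
  mu e x eta = \dim (mximg (dual_idem R e x 2) (Hsub e x eta)) /\
  (mult e x eta >= mu e x eta)%N.
Proof.
have D_ge3 : (3 <= diameter e)%N := ltnW D_ge4.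
have muE := mu_dim x e_sym e_irr e_conn e_bip e_dreg (ltnW D_ge3) eta.
by split=> //; rewrite muE; apply: dim_Hsub_le_mult.
Qed.
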